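(* Let $\lambda\in[-1,1)$, let $I\subset\mathbb{R}$ be an interval and let $\gamma:I\to\mathbb{R}^2$ be a $\lambda$-eel with bounded image. Then $\gamma$ is rectifiable and has finite length.
   Context: $\mathbb{R}^2$ carries the Euclidean inner product $\langle\cdot,\cdot\rangle$ and norm $\|\cdot\|$. For $\lambda\in[-1,1)$, a $\lambda$-eel is a continuous curve $\gamma:I\to\mathbb{R}^d$ which has at each point a nonzero right derivative $\gamma'(\tau)$ and satisfies, for all $t<\tau$ in $I$, $\langle\gamma'(\tau),\gamma(t)-\gamma(\tau)\rangle\le\lambda\,\|\gamma'(\tau)\|\,\|\gamma(t)-\gamma(\tau)\|$. The length of $\gamma$ is $\sup\sum_{i=0}^{m-1}\|\gamma(t_i)-\gamma(t_{i+1})\|$ over finite increasing sequences $t_0<\dots<t_m$ in $I$; $\gamma$ is rectifiable if its length is finite on every compact subinterval of $I$. *)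

(* Defs.v *)
From Stdlib Require Import Reals List Sorting.Sorted.
Open Scope R_scope.

Definition vec := (R * R)%type.
Definition vsub (p q : vec) : vec := (fst p - fst q, snd p - snd q).
Definition vscale (c : R) (p : vec) : vec := (c * fst p, c * snd p).
Definition inner (p q : vec) : R := fst p * fst q + snd p * snd q.
Definition vnorm (p : vec) : R := sqrt (inner p p).

Definition is_interval (I : R -> Prop) : Prop :=
  forall x y z, I x -> I z -> x <= y -> y <= z -> I y.

Definition continuous_on (I : R -> Prop) (g : R -> vec) : Prop :=
  forall t, I t -> forall eps, 0 < eps -> exists delta, 0 < delta /\
    forall s, I s -> Rabs (s - t) < delta -> vnorm (vsub (g s) (g t)) < eps.

Definition is_right_deriv (I : R -> Prop) (g : R -> vec) (tau : R) (d : vec) : Prop :=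
  forall eps, 0 < eps -> exists delta, 0 < delta /\
    forall h, 0 < h -> h < delta -> I (tau + h) ->
      vnorm (vsub (vscale (/ h) (vsub (g (tau + h)) (g tau))) d) < eps.

(* tau is the largest element of I (where a right derivative makes no sense) *)
Definition is_max_of (I : R -> Prop) (tau : R) : Prop :=
  I tau /\ forall s, I s -> s <= tau.

Definition is_eel (lam : R) (I : R -> Prop) (g : R -> vec) : Prop :=
  continuous_on I g /\
  forall tau, I tau -> ~ is_max_of I tau ->
    exists d, is_right_deriv I g tau d /\ d <> (0, 0) /\
      forall t, I t -> t < tau ->
        inner d (vsub (g t) (g tau))
          <= lam * vnorm d * vnorm (vsub (g t) (g tau)).

Fixpoint poly_len (g : R -> vec) (ts : list R) : R :=
  match ts with
  | t1 :: ((t2 :: _) as rest) => vnorm (vsub (g t1) (g t2)) + poly_len g rest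
  | _ => 0
  end.

Definition finite_length (I : R -> Prop) (g : R -> vec) : Prop :=
  exists M, forall ts, Sorted Rlt ts -> Forall I ts -> poly_len g ts <= M.

Definition rectifiable (I : R -> Prop) (g : R -> vec) : Prop :=
  forall a b, I a -> I b ->
    finite_length (fun t => I t /\ a <= t <= b) g.

Definition bounded_image (I : R -> Prop) (g : R -> vec) : Prop :=
  exists M, forall t, I t -> vnorm (g t) <= M.

(* Main.v *)
(* Fix k with max(lam, 0) < k < 1.  The key fact is that, seen from the point g(t),
   the earlier points of the eel together with the backward velocity lie in a sector
   of aperture acos(-k) < pi.  For two earlier times u < s, let f(t) be the variation
   of the argument of g(t) - g(x) as x runs from u to s.  As the velocity v(t) makes
   an angle at most acos(-lam) with every g(t) - g(x), it provides a determination of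
   all these arguments at once.  This keeps |f| <= acos(-k): it holds just after s, and
   at equality v(t) points so as to decrease |f|.  No lifting of angles is needed: f is
   encoded by the inner product of the two directions and by the sign of [tri].

   The variation f only makes sense while g(t) avoids g([u, s]), so injectivity comes
   first.  Around a suitable first self-intersection the argument above applies, and
   points converging to an earlier point p would have pairwise separated directions
   from p, which is impossible in the plane.

   Consequently g(t) is always an extreme point of the hull of the past, and moves
   outwards at a rate comparable to its speed for one of finitely many directions.
   The sum of the corresponding support functions is bounded and dominates length. *)
Require Import Defs.
From Stdlib Require Import Reals List Sorting.Sorted Lia Lra Psatz Nsatz.
From Stdlib Require Import Classical IndefiniteDescription.
Open Scope R_scope.

(** * Half-angle trigonometry in algebraic form *)

Definition cross (p q : vec) : R := fst p * snd q - snd p * fst q.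
(* Zero exactly when [p] and [q] have opposite directions (or one vanishes). *)
Definition opening (p q : vec) : R := vnorm p * vnorm q + inner p q.
(* For unit vectors at angles [a], [b], [c] one has
   [tri = 4 cos ((a - b) / 2) cos ((b - c) / 2) cos ((c - a) / 2)]; its sign decides
   whether three vectors with no two opposite lie in an open half-plane. *)
Definition tri (p q r : vec) : R :=
  vnorm p * vnorm q * vnorm r
  + vnorm p * inner q r + vnorm q * inner p r + vnorm r * inner p q.
(** Companion of [tri]: for unit vectors at angles [a], [b], [c] it equals [4 cos ((a - b) / 2) cos
    ((c - a) / 2) sin ((c - b) / 2)]. *)
Definition cotri (p q r : vec) : R :=
  vnorm q * cross p r - vnorm r * cross p q + vnorm p * cross q r.

Lemma vnorm_sqr (p : vec) : vnorm p * vnorm p = inner p p.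
Proof. apply sqrt_sqrt. unfold inner. nra. Qed.

Lemma vnorm_ge0 (p : vec) : 0 <= vnorm p.
Proof. apply sqrt_pos. Qed.

Lemma vnorm_gt0 (p : vec) : p <> (0, 0) -> 0 < vnorm p.
Proof.
  intros Hp. apply sqrt_lt_R0. destruct p as [x y]. unfold inner; simpl.
  destruct (Req_dec x 0) as [->|Hx]; [destruct (Req_dec y 0) as [->|Hy]|].
  - now contradiction Hp.
  - nra.
  - nra.
Qed.

(** Real part of [(tri + i cotri)^2 = 4 (opening p q) (opening p r) (inner q r + i cross q r)]; the
    next lemma is half of the imaginary part. *)
Lemma tri_sqr_sub (p q r : vec) :
  tri p q r * tri p q r - cotri p q r * cotri p q r
  = 4 * opening p q * opening p r * inner q r.
Proof.
  assert (Hp := vnorm_sqr p). assert (Hq := vnorm_sqr q).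
  assert (Hr := vnorm_sqr r).
  unfold tri, cotri, opening, cross, inner in *.
  destruct p as [x1 y1], q as [x2 y2], r as [x3 y3]; simpl in *.
  (* Only the squares of the norms matter; as free variables they leave a polynomial identity. *)
  set (a := vnorm (x1,y1)) in *. set (b := vnorm (x2,y2)) in *.
  set (c := vnorm (x3,y3)) in *. clearbody a b c.
  nsatz.
Qed.

Lemma tri_mul_cotri (p q r : vec) :
  tri p q r * cotri p q r = 2 * opening p q * opening p r * cross q r.
Proof.
  assert (Hp := vnorm_sqr p). assert (Hq := vnorm_sqr q).
  assert (Hr := vnorm_sqr r).
  unfold tri, cotri, opening, cross, inner in *.
  destruct p as [x1 y1], q as [x2 y2], r as [x3 y3]; simpl in *.
  set (a := vnorm (x1,y1)) in *. set (b := vnorm (x2,y2)) in *.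
  set (c := vnorm (x3,y3)) in *. clearbody a b c.
  nsatz.
Qed.

(** Up to norms each [opening] is twice a squared half-angle cosine. Hence [tri] vanishes only if
    two of the vectors are opposite or one is zero. *)
Lemma tri_sqr (p q r : vec) :
  tri p q r * tri p q r
  = 2 * opening p q * opening p r * opening q r.
Proof.
  assert (Hp := vnorm_sqr p). assert (Hq := vnorm_sqr q).
  assert (Hr := vnorm_sqr r).
  unfold tri, opening, inner in *.
  destruct p as [x1 y1], q as [x2 y2], r as [x3 y3]; simpl in *.
  set (a := vnorm (x1,y1)) in *. set (b := vnorm (x2,y2)) in *.
  set (c := vnorm (x3,y3)) in *. clearbody a b c.
  nsatz.
Qed.

(** * Inner product and norm *)

Definition vadd (p q : vec) : vec := (fst p + fst q, snd p + snd q).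

Ltac vring :=
  repeat match goal with p : vec |- _ => destruct p end;
  unfold cross, inner, vadd, vsub, vscale; simpl; ring.

Lemma inner_comm (p q : vec) : inner p q = inner q p.
Proof. vring. Qed.

Lemma inner_addl (p q r : vec) : inner (vadd p q) r = inner p r + inner q r.
Proof. vring. Qed.

Lemma inner_addr (p q r : vec) : inner r (vadd p q) = inner r p + inner r q.
Proof. vring. Qed.

Lemma inner_scalel (c : R) (p q : vec) : inner (vscale c p) q = c * inner p q.
Proof. vring. Qed.

Lemma inner_scaler (c : R) (p q : vec) : inner q (vscale c p) = c * inner q p.
Proof. vring. Qed.

Lemma sqr_le_le (x y : R) : 0 <= y -> x * x <= y * y -> x <= y.
Proof. nra. Qed.

Lemma inner_le (p q : vec) : inner p q <= vnorm p * vnorm q.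
Proof.
  assert (Hp := vnorm_sqr p). assert (Hq := vnorm_sqr q).
  assert (Hp0 := vnorm_ge0 p). assert (Hq0 := vnorm_ge0 q).
  apply sqr_le_le; [nra|].
  replace (vnorm p * vnorm q * (vnorm p * vnorm q)) with (inner p p * inner q q)
    by (rewrite <- Hp, <- Hq; ring).
  assert (Hc := Rle_0_sqr (cross p q)). unfold Rsqr, cross in Hc.
  unfold inner. nra.
Qed.

Lemma inner_ge (p q : vec) : - (vnorm p * vnorm q) <= inner p q.
Proof.
  assert (H := inner_le (vscale (-1) p) q).
  replace (vnorm (vscale (-1) p)) with (vnorm p) in H
    by (unfold vnorm; f_equal; vring).
  rewrite inner_scalel in H. lra.
Qed.

Lemma vnorm_add_le (p q : vec) : vnorm (vadd p q) <= vnorm p + vnorm q.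
Proof.
  assert (Hp0 := vnorm_ge0 p). assert (Hq0 := vnorm_ge0 q).
  apply sqr_le_le; [lra|].
  rewrite vnorm_sqr, inner_addl, !inner_addr, (inner_comm q p).
  assert (H := inner_le p q).
  assert (Hp := vnorm_sqr p). assert (Hq := vnorm_sqr q). nra.
Qed.

Lemma vnorm_sub_comm (p q : vec) : vnorm (vsub p q) = vnorm (vsub q p).
Proof. unfold vnorm. f_equal. vring. Qed.

Lemma vnorm_add_ge (p q : vec) : vnorm p - vnorm q <= vnorm (vadd p q).
Proof.
  assert (H := vnorm_add_le (vadd p q) (vscale (-1) q)).
  replace (vadd (vadd p q) (vscale (-1) q)) with p in H
    by (destruct p, q; unfold vadd, vscale; simpl; f_equal; ring).
  replace (vnorm (vscale (-1) q)) with (vnorm q) in H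
    by (unfold vnorm; f_equal; vring).
  lra.
Qed.

Lemma vnorm_scale (c : R) (p : vec) : 0 <= c -> vnorm (vscale c p) = c * vnorm p.
Proof.
  intros Hc. unfold vnorm. rewrite inner_scalel, inner_scaler, <- Rmult_assoc.
  rewrite sqrt_mult_alt by nra. now rewrite sqrt_square.
Qed.

Lemma vnorm_eq0 (p : vec) : vnorm p = 0 -> p = (0, 0).
Proof.
  intros Hp. destruct (Req_dec (fst p) 0) as [H1|H1];
    [destruct (Req_dec (snd p) 0) as [H2|H2]|].
  - destruct p; simpl in *; congruence.
  - enough (0 < vnorm p) by lra. apply vnorm_gt0. intros ->. now simpl in H2.
  - enough (0 < vnorm p) by lra. apply vnorm_gt0. intros ->. now simpl in H1.
Qed.

(** * First-order change of the angle between two displacements *)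

(** The norm is convex, so it lies above its linearization at [p]; this is Cauchy-Schwarz against
    [p]. *)
Lemma vnorm_add_tangent (p z : vec) : 0 < vnorm p ->
  vnorm p + inner p z / vnorm p <= vnorm (vadd p z).
Proof.
  intros Hp. apply Rmult_le_reg_l with (vnorm p); [easy|].
  replace (vnorm p * (vnorm p + inner p z / vnorm p))
    with (vnorm p * vnorm p + inner p z) by (field; lra).
  rewrite vnorm_sqr, <- inner_addr. apply inner_le.
Qed.

(* The Gram determinant of the unit vectors along [v], [p], [q]. *)
Lemma gram_vanishes (v p q : vec) (A B k : R) :
  0 < vnorm v -> 0 < vnorm p -> 0 < vnorm q ->
  inner v p = A * (vnorm v * vnorm p) -> inner v q = B * (vnorm v * vnorm q) ->
  inner p q = - k * (vnorm p * vnorm q) ->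
  A * A + B * B + k * k + 2 * k * A * B = 1.
Proof.
  intros Hv Hp Hq HA HB Hk.
  assert (Hv2 := vnorm_sqr v). assert (Hp2 := vnorm_sqr p).
  assert (Hq2 := vnorm_sqr q). unfold inner in *.
  set (a := vnorm v) in *. set (b := vnorm p) in *. set (c := vnorm q) in *.
  clearbody a b c.
  destruct v as [x1 y1], p as [x2 y2], q as [x3 y3]; simpl in *.
  (* Three vectors of the plane are dependent, so their Gram determinant is zero; the norms are then
     divided out. *)
  assert (H : (a * a) * (b * b) * (c * c)
              * (A * A + B * B + k * k + 2 * k * A * B - 1) = 0) by nsatz.
  assert (0 < (a * a) * (b * b) * (c * c)) by (repeat apply Rmult_lt_0_compat; lra).
  nra.
Qed.

(** Put [A = cos x], [B = cos y], [- k = cos z] with angles in [[0, PI]]. The Gram relation leaves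
    [z = x + y], [z = |x - y|] or [z = 2 PI - x - y]. The bounds [- k < A] and [- k < B] exclude the
    second case and the positive sum excludes the third, so [B + k * A = sin x sin z > 0]. *)
Lemma acute_side (A B k : R) : 0 <= k < 1 -> - k < A -> - k < B -> A <= 1 ->
  A * A + B * B + k * k + 2 * k * A * B = 1 -> 0 < 1 - k + A + B ->
  0 < B + k * A.
Proof.
  intros Hk HA HB HA1 HG HN. apply Rnot_le_lt. intros HC.
  (* This reads [B + k * A = ± sin x sin z]; the minus sign is refuted below. *)
  assert (HS : (B + k * A) * (B + k * A) = (1 - k * k) * (1 - A * A)) by nra.
  set (D := - (B + k * A)) in *.
  assert (HD0 : 0 <= D) by (unfold D; lra).
  assert (HD1 : D < k * (1 - A)) by (unfold D; lra).
  assert (HD2 : D < (1 - k) * (1 + A)) by (unfold D; nra).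
  assert (HDD : D * D = (1 - k * k) * (1 - A * A)) by (unfold D; nra).
  assert (HA2 : A < 1) by nra.
  assert (H1 : D * D < (k * (1 - A)) * (k * (1 - A))) by nra.
  assert (H2 : D * D < ((1 - k) * (1 + A)) * ((1 - k) * (1 + A))) by nra.
  assert (H3 : (1 - k * k) * (1 + A) < k * k * (1 - A)).
  { apply Rmult_lt_reg_l with (1 - A); nra. }
  assert (H4 : (1 + k) * (1 - A) < (1 - k) * (1 + A)).
  { apply Rmult_lt_reg_l with ((1 - k) * (1 + A)); [|nra].
    apply Rmult_lt_0_compat; lra. }
  nra.
Qed.

(* Derivative of [inner p q + k * vnorm p * vnorm q] when both [p] and [q] move
   with velocity [z]. *)
Definition spread_rate (k : R) (p q z : vec) : R :=
  inner z p + inner z q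
  + k * (vnorm q * (inner p z / vnorm p) + vnorm p * (inner q z / vnorm q)).

(** At the extremal angle [acos (- k)] the vector [v] points strictly between [p] and [q], so moving
    both along [v] closes the angle. The hypothesis on [tri] excludes the reflex side. *)
Lemma spread_rate_pos (k : R) (v p q : vec) : 0 <= k < 1 ->
  0 < vnorm v -> 0 < vnorm p -> 0 < vnorm q ->
  - k * (vnorm v * vnorm p) < inner v p ->
  - k * (vnorm v * vnorm q) < inner v q ->
  inner p q = - k * (vnorm p * vnorm q) ->
  0 < tri v p q -> 0 < spread_rate k p q v.
Proof.
  intros Hk Hv Hp Hq HA HB HC HN.
  set (A := inner v p / (vnorm v * vnorm p)).
  set (B := inner v q / (vnorm v * vnorm q)).
  assert (HvA : inner v p = A * (vnorm v * vnorm p)) by (unfold A; field; lra).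
  assert (HvB : inner v q = B * (vnorm v * vnorm q)) by (unfold B; field; lra).
  assert (HG := gram_vanishes v p q A B k Hv Hp Hq HvA HvB HC).
  assert (H1 := inner_le v p). assert (H2 := inner_le v q).
  assert (Hvp : 0 < vnorm v * vnorm p) by nra.
  assert (Hvq : 0 < vnorm v * vnorm q) by nra.
  rewrite HvA in HA, H1. rewrite HvB in HB, H2.
  assert (HA' : - k < A) by nra. assert (HB' : - k < B) by nra.
  assert (HA1 : A <= 1) by nra. assert (HB1 : B <= 1) by nra.
  assert (HN' : 0 < 1 - k + A + B).
  { unfold tri in HN. rewrite HvA, HvB, HC in HN.
    apply Rmult_lt_reg_l with (vnorm v * vnorm p * vnorm q);
      [repeat apply Rmult_lt_0_compat; lra|]. nra. }
  assert (HBA := acute_side A B k Hk HA' HB' HA1 HG HN').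
  assert (HAB : 0 < A + k * B).
  { apply (acute_side B A k); try easy; lra. }
  unfold spread_rate. rewrite (inner_comm p v), (inner_comm q v), HvA, HvB.
  replace (_ + _) with
    (vnorm v * (vnorm p * (A + k * B) + vnorm q * (B + k * A)))
    by (field; lra).
  apply Rmult_lt_0_compat; [easy|].
  apply Rplus_lt_0_compat; apply Rmult_lt_0_compat; easy.
Qed.

(** Controls the contribution of the remainder in a first-order expansion of the curve. *)
Lemma spread_rate_ge (k : R) (p q e : vec) : 0 <= k ->
  0 < vnorm p -> 0 < vnorm q ->
  - ((1 + k) * (vnorm p + vnorm q) * vnorm e) <= spread_rate k p q e.
Proof.
  intros Hk Hp Hq.
  assert (H1 := inner_ge e p). assert (H2 := inner_ge e q).
  unfold spread_rate. rewrite (inner_comm p e), (inner_comm q e).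
  assert (H3 : - vnorm e <= inner e p / vnorm p).
  { apply Rmult_le_reg_r with (vnorm p); [easy|]. field_simplify; lra. }
  assert (H4 : - vnorm e <= inner e q / vnorm q).
  { apply Rmult_le_reg_r with (vnorm q); [easy|]. field_simplify; lra. }
  assert (H5 : - (vnorm q * vnorm e) <= vnorm q * (inner e p / vnorm p)) by nra.
  assert (H6 : - (vnorm p * vnorm e) <= vnorm p * (inner e q / vnorm q)) by nra.
  assert (H7 : - (k * (vnorm q * vnorm e + vnorm p * vnorm e)) <=
    k * (vnorm q * (inner e p / vnorm p) + vnorm p * (inner e q / vnorm q)))
    by nra.
  lra.
Qed.

Lemma spread_rate_linear (k h : R) (p q v e : vec) :
  spread_rate k p q (vadd (vscale h v) e)
  = h * spread_rate k p q v + spread_rate k p q e.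
Proof.
  unfold spread_rate.
  rewrite !inner_addl, !inner_addr, !inner_scalel, !inner_scaler.
  unfold Rdiv. ring.
Qed.

(** Replacing the norms by their tangents leaves the first-order rate plus [|z|^2 + k s t], where
    [|s|, |t| <= |z|]. This second-order term is nonnegative, so no error term appears. The bounds
    on [|z|] keep the tangent values nonnegative before they are multiplied. *)
Lemma spread_translate (k : R) (p q z : vec) : 0 <= k <= 1 ->
  0 < vnorm p -> 0 < vnorm q -> vnorm z <= vnorm p -> vnorm z <= vnorm q ->
  inner p q = - k * (vnorm p * vnorm q) -> 0 <= spread_rate k p q z ->
  - k * (vnorm (vadd p z) * vnorm (vadd q z)) <= inner (vadd p z) (vadd q z).
Proof.
  intros Hk Hp Hq Hzp Hzq HC HL.
  assert (Tp := vnorm_add_tangent p z Hp). assert (Tq := vnorm_add_tangent q z Hq).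
  assert (Ip : - vnorm z <= inner p z / vnorm p <= vnorm z).
  { assert (H1 := inner_ge p z). assert (H2 := inner_le p z).
    split; apply Rmult_le_reg_r with (vnorm p); try easy; field_simplify; lra. }
  assert (Iq : - vnorm z <= inner q z / vnorm q <= vnorm z).
  { assert (H1 := inner_ge q z). assert (H2 := inner_le q z).
    split; apply Rmult_le_reg_r with (vnorm q); try easy; field_simplify; lra. }
  rewrite inner_addl, !inner_addr, (inner_comm p z), HC, <- vnorm_sqr.
  unfold spread_rate in HL.
  set (P := vnorm p) in *. set (Q := vnorm q) in *. set (Z := vnorm z) in *.
  set (s := inner p z / P) in *. set (t := inner q z / Q) in *.
  assert (HM : (P + s) * (Q + t) <= vnorm (vadd p z) * vnorm (vadd q z)).
  { apply Rmult_le_compat; lra. }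
  assert (Hst : - (Z * Z) <= s * t) by nra.
  assert (HZ : 0 <= Z * Z) by nra.
  assert (HkM : k * ((P + s) * (Q + t))
                <= k * (vnorm (vadd p z) * vnorm (vadd q z)))
    by (apply Rmult_le_compat_l; lra).
  assert (k * - (Z * Z) <= k * (s * t)) by (apply Rmult_le_compat_l; lra).
  nra.
Qed.

(** * Continuity of expressions in planar curves *)

Lemma continuity_add (f g : R -> R) :
  continuity f -> continuity g -> continuity (fun t => f t + g t).
Proof. exact (continuity_plus f g). Qed.

Lemma continuity_sub (f g : R -> R) :
  continuity f -> continuity g -> continuity (fun t => f t - g t).
Proof. exact (continuity_minus f g). Qed.

Lemma continuity_mul (f g : R -> R) :
  continuity f -> continuity g -> continuity (fun t => f t * g t).
Proof. exact (continuity_mult f g). Qed.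

Lemma continuity_cst (c : R) : continuity (fun _ => c).
Proof. apply continuity_const. now intros x y. Qed.

Definition vcontinuity (w : R -> vec) : Prop :=
  continuity (fun t => fst (w t)) /\ continuity (fun t => snd (w t)).

Lemma continuity_inner (w1 w2 : R -> vec) :
  vcontinuity w1 -> vcontinuity w2 -> continuity (fun t => inner (w1 t) (w2 t)).
Proof.
  intros [H1 H2] [H3 H4]. unfold inner.
  apply continuity_add; now apply continuity_mul.
Qed.

Lemma continuity_cross (w1 w2 : R -> vec) :
  vcontinuity w1 -> vcontinuity w2 -> continuity (fun t => cross (w1 t) (w2 t)).
Proof.
  intros [H1 H2] [H3 H4]. unfold cross.
  apply continuity_sub; now apply continuity_mul.
Qed.

Lemma continuity_vnorm (w : R -> vec) :
  vcontinuity w -> continuity (fun t => vnorm (w t)).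
Proof.
  intros Hw t. unfold vnorm.
  apply (continuity_pt_comp (fun t => inner (w t) (w t)) sqrt).
  - now apply continuity_inner.
  - apply continuity_pt_sqrt. unfold inner. nra.
Qed.

Lemma vcontinuity_cst (p : vec) : vcontinuity (fun _ => p).
Proof. split; apply continuity_cst. Qed.

Lemma vcontinuity_sub (w1 w2 : R -> vec) :
  vcontinuity w1 -> vcontinuity w2 -> vcontinuity (fun t => vsub (w1 t) (w2 t)).
Proof.
  intros [H1 H2] [H3 H4]. split; unfold vsub; simpl; now apply continuity_sub.
Qed.

Ltac cont :=
  repeat first
    [ assumption | apply vcontinuity_cst | apply continuity_cst
    | apply vcontinuity_sub | apply continuity_vnorm
    | apply continuity_inner | apply continuity_cross
    | apply continuity_sub | apply continuity_add | apply continuity_mul ].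

Lemma continuity_pos_near (f : R -> R) (t : R) : continuity f -> 0 < f t ->
  exists d, 0 < d /\ forall s, Rabs (s - t) < d -> 0 < f s.
Proof.
  intros Hf Ht. destruct (Hf t (f t) Ht) as [d [Hd H]].
  exists d. split; [easy|]. intros s Hs.
  destruct (Req_dec s t) as [->|Hst]; [easy|].
  assert (HH : Rabs (f s - f t) < f t).
  { apply (H s). repeat split; auto. }
  apply Rabs_def2 in HH. lra.
Qed.

(** * Changing the frame in which the sign of [tri] is read *)

Lemma tri_self (v p : vec) : tri v p p = 2 * vnorm p * opening v p.
Proof.
  unfold tri, opening. rewrite <- (vnorm_sqr p). ring.
Qed.

Lemma cotri_self (v p : vec) : cotri v p p = 0.
Proof. unfold cotri, cross. ring. Qed.

(* [tri + i cotri] is, up to a positive factor, a square root of the complex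
   number [q / p]; the frame [v] only selects the branch. *)
Lemma tri_frame (w : R -> vec) (v v' : vec) (u s : R) : vcontinuity w -> u <= s ->
  (forall t, u <= t <= s -> 0 < opening v (w t)) ->
  (forall t, u <= t <= s -> 0 < opening v' (w t)) ->
  (forall t, u <= t <= s -> 0 < vnorm (w t)) ->
  0 < tri v (w u) (w s) -> 0 < tri v' (w u) (w s).
Proof.
  intros Hw Hus Ov Ov' Wn HN.
  (* [k] and [i] are the real and imaginary parts of the conjugate of [tri + i cotri] for [v] times
     its value for [v']. The square of this product is a positive real, so the product itself is
     real or imaginary; it is real because [k] cannot vanish. By continuity [k] keeps the positive
     sign it has at [u]. *)
  set (k t := tri v (w u) (w t) * tri v' (w u) (w t)
              + cotri v (w u) (w t) * cotri v' (w u) (w t)).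
  set (i t := tri v (w u) (w t) * cotri v' (w u) (w t)
              - cotri v (w u) (w t) * tri v' (w u) (w t)).
  assert (Hk : forall t, u <= t <= s -> k t <> 0).
  { intros t Ht E.
    assert (S1 := tri_sqr_sub v (w u) (w t)). assert (S2 := tri_sqr_sub v' (w u) (w t)).
    assert (M1 := tri_mul_cotri v (w u) (w t)). assert (M2 := tri_mul_cotri v' (w u) (w t)).
    assert (HP : 0 < (opening v (w u) * opening v (w t))
      * (opening v' (w u) * opening v' (w t))
      * ((vnorm (w u) * vnorm (w u)) * (vnorm (w t) * vnorm (w t)))).
    { assert (u <= u <= s) by lra.
      repeat apply Rmult_lt_0_compat; auto. }
    assert (HI : k t * k t - i t * i t =
      16 * ((opening v (w u) * opening v (w t))
      * (opening v' (w u) * opening v' (w t))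
      * (inner (w u) (w t) * inner (w u) (w t) + cross (w u) (w t) * cross (w u) (w t)))).
    { unfold k, i. revert S1 S2 M1 M2.
      generalize (tri v (w u) (w t)) (tri v' (w u) (w t)) (cotri v (w u) (w t))
        (cotri v' (w u) (w t)). intros.
      transitivity ((r * r - r1 * r1) * (r0 * r0 - r2 * r2)
                    + 4 * (r * r1) * (r0 * r2)); [ring|].
      rewrite S1, S2, M1, M2. ring. }
    rewrite !vnorm_sqr in HP.
    replace (inner (w u) (w u) * inner (w t) (w t)) with
      (inner (w u) (w t) * inner (w u) (w t) + cross (w u) (w t) * cross (w u) (w t))
      in HP by (unfold inner, cross; ring).
    assert (0 <= i t * i t) by nra. rewrite E in HI. lra. }
  assert (Hi : i s = 0).
  { assert (E : k s * i s = 0).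
    { assert (S1 := tri_sqr_sub v (w u) (w s)). assert (S2 := tri_sqr_sub v' (w u) (w s)).
      assert (M1 := tri_mul_cotri v (w u) (w s)). assert (M2 := tri_mul_cotri v' (w u) (w s)).
      unfold k, i. revert S1 S2 M1 M2.
      generalize (tri v (w u) (w s)) (tri v' (w u) (w s)) (cotri v (w u) (w s))
        (cotri v' (w u) (w s)). intros.
      transitivity ((r * r - r1 * r1) * (r0 * r2) - (r * r1) * (r0 * r0 - r2 * r2));
        [ring|].
      rewrite S1, S2, M1, M2. ring. }
    apply Rmult_integral in E. destruct E as [E|E]; [|easy].
    exfalso. apply (Hk s); lra. }
  assert (Ck : continuity k).
  { unfold k, tri, cotri. cont. }
  assert (Hk0 : 0 < k u).
  { unfold k. rewrite !tri_self, !cotri_self.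
    assert (0 < vnorm (w u)) by (apply Wn; lra).
    assert (0 < opening v (w u)) by (apply Ov; lra).
    assert (0 < opening v' (w u)) by (apply Ov'; lra).
    assert (0 < 2 * vnorm (w u)) by lra.
    rewrite Rmult_0_l, Rplus_0_r. repeat apply Rmult_lt_0_compat; lra. }
  assert (Hks : 0 < k s).
  { apply Rnot_le_lt. intros HC. assert (HP : k u * k s <= 0) by nra.
    destruct (IVT_cor k u s Ck Hus HP) as [z [Hz E]].
    now apply (Hk z). }
  unfold k, i in *. revert HN Hi Hks.
  generalize (tri v (w u) (w s)) (tri v' (w u) (w s)) (cotri v (w u) (w s))
    (cotri v' (w u) (w s)). intros N N' M M' HN Hi Hks.
  assert (E : N * (N * N' + M * M') = N' * (N * N + M * M)).
  { transitivity (N * N * N' + M * (N * M')); [ring|].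
    replace (N * M') with (M * N') by lra. ring. }
  apply Rnot_le_lt. intros HC. nra.
Qed.

(** * Arcs over a compact interval and their behaviour just after a given time *)

(** Working form of an eel on [[a, b]]: [g] is continuous on the whole line, the right derivative is
    a chosen function [v], and [lam] is nonnegative. Displacements point away from the past, whence
    the sign in [arc_past]. *)
Record eel_arc (lam a b : R) (g v : R -> vec) : Prop := {
  arc_lam : 0 <= lam < 1;
  arc_cont : vcontinuity g;
  arc_speed : forall t, a <= t < b -> 0 < vnorm (v t);
  arc_step : forall t, a <= t < b -> forall eps, 0 < eps ->
    exists d, 0 < d /\ forall t', t < t' < t + d -> t' <= b ->
      vnorm (vsub (vsub (g t') (g t)) (vscale (t' - t) (v t))) <= eps * (t' - t);
  arc_past : forall u t, a <= u <= t -> t < b ->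
    - lam * (vnorm (v t) * vnorm (vsub (g t) (g u)))
      <= inner (v t) (vsub (g t) (g u)) }.

(** Otherwise [v] and [w] would be opposite, and the normalized inner products with [z] would sum to
    zero, whereas they sum to at least [m - k]. *)
Lemma opening_pos (k m : R) (v w z : vec) : k < m ->
  0 < vnorm v -> 0 < vnorm w -> 0 < vnorm z ->
  m * (vnorm v * vnorm z) <= inner v z -> - k * (vnorm w * vnorm z) <= inner w z ->
  0 < opening v w.
Proof.
  intros Hkm Hv Hw Hz H1 H2. apply Rnot_le_lt. intros HC.
  set (y := vadd (vscale (vnorm w) v) (vscale (vnorm v) w)).
  assert (Hy : vnorm y * vnorm y = 2 * (vnorm v * vnorm w) * opening v w).
  { rewrite vnorm_sqr. unfold y, opening.
    rewrite !inner_addl, !inner_addr, !inner_scalel, !inner_scaler, <- !vnorm_sqr.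
    rewrite (inner_comm w v). ring. }
  assert (Hy0 : vnorm y = 0).
  { assert (H := vnorm_ge0 y). assert (0 < vnorm v * vnorm w) by nra. nra. }
  assert (E : inner y z = 0).
  { rewrite (vnorm_eq0 y Hy0). unfold inner; simpl; ring. }
  unfold y in E. rewrite inner_addl, !inner_scalel in E.
  assert (0 < vnorm v * vnorm w * vnorm z) by (repeat apply Rmult_lt_0_compat; easy).
  assert (vnorm w * (m * (vnorm v * vnorm z)) <= vnorm w * inner v z)
    by (apply Rmult_le_compat_l; lra).
  assert (vnorm v * (- k * (vnorm w * vnorm z)) <= vnorm v * inner w z)
    by (apply Rmult_le_compat_l; lra).
  nra.
Qed.

Lemma vsub_split (p q r : vec) : vsub p q = vadd (vsub r q) (vsub p r).
Proof. destruct p, q, r; unfold vadd, vsub; simpl; f_equal; ring. Qed.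

(* The point just reached lies almost in the direction [v t], hence well inside the
   cone that is free of earlier points. *)
Lemma arc_launch (lam a b k : R) (g v : R -> vec) (t : R) : eel_arc lam a b g v ->
  lam < k < 1 -> a <= t < b ->
  exists d, 0 < d /\ forall t', t < t' < t + d -> t' <= b ->
    0 < vnorm (vsub (g t') (g t)) /\
    (1 + k) / 2 * (vnorm (v t) * vnorm (vsub (g t') (g t)))
      <= inner (v t) (vsub (g t') (g t)) /\
    forall u, a <= u <= t ->
      0 < vnorm (vsub (g t') (g u)) /\
      - k * (vnorm (vsub (g t') (g u)) * vnorm (vsub (g t') (g t)))
        <= inner (vsub (g t') (g u)) (vsub (g t') (g t)) /\
      0 < opening (v t) (vsub (g t') (g u)).
Proof.
  intros HA Hk Ht. assert (Hlam := arc_lam _ _ _ _ _ HA).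
  assert (Hv := arc_speed _ _ _ _ _ HA t Ht).
  (* Relative error of the linear approximation. The first bound gives
     [(1 + k) / 2 * (1 + e) <= 1 - e], the second [lam + e <= k * (1 - e)]. *)
  set (e := Rmin ((1 - k) / 4) ((k - lam) / 2)).
  assert (He : 0 < e) by (unfold e; apply Rmin_pos; lra).
  assert (He1 : e <= (1 - k) / 4) by apply Rmin_l.
  assert (He2 : e <= (k - lam) / 2) by apply Rmin_r. clearbody e.
  destruct (arc_step _ _ _ _ _ HA t Ht (e * vnorm (v t))) as [d [Hd H]]; [nra|].
  exists d. split; [easy|]. intros t' Ht' Hb. specialize (H t' Ht' Hb).
  set (z := vsub (g t') (g t)) in *. set (h := t' - t) in *.
  assert (Hh : 0 < h) by (unfold h; lra).
  set (r := vsub z (vscale h (v t))) in *.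
  assert (Ez : z = vadd (vscale h (v t)) r).
  { unfold r. destruct z, (v t); unfold vadd, vsub, vscale; simpl; f_equal; ring. }
  set (V := vnorm (v t)) in *.
  assert (Hz1 := vnorm_add_ge (vscale h (v t)) r).
  assert (Hz2 := vnorm_add_le (vscale h (v t)) r).
  rewrite <- Ez, vnorm_scale in Hz1, Hz2 by lra. fold V in Hz1, Hz2.
  assert (HV : 0 < h * V) by nra.
  assert (Hza : (h * V) * (1 - e) <= vnorm z) by nra.
  assert (Hzb : vnorm z <= (h * V) * (1 + e)) by nra.
  assert (Hz : 0 < vnorm z) by nra.
  assert (Hvz : (1 + k) / 2 * (V * vnorm z) <= inner (v t) z).
  { rewrite Ez, inner_addr, inner_scaler, <- vnorm_sqr, <- Ez. fold V.
    assert (Hr := inner_ge (v t) r). fold V in Hr.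
    assert (V * vnorm r <= V * (e * V * h)) by (apply Rmult_le_compat_l; lra).
    assert (V * vnorm z <= V * ((h * V) * (1 + e))) by (apply Rmult_le_compat_l; lra).
    assert (HVV : 0 < V * (h * V)) by nra.
    assert ((1 + k) / 2 * (V * vnorm z) <= (1 + k) / 2 * (V * ((h * V) * (1 + e))))
      by (apply Rmult_le_compat_l; lra).
    assert ((1 + k) / 2 * (1 + e) <= 1 - e) by nra.
    nra. }
  split; [easy|]. split; [easy|].
  intros u Hu. set (w := vsub (g t') (g u)). set (w0 := vsub (g t) (g u)).
  assert (Ew : w = vadd w0 z) by apply vsub_split.
  assert (Hp := arc_past _ _ _ _ _ HA u t Hu (proj2 Ht)). fold w0 V in Hp.
  assert (Hw0 := vnorm_ge0 w0).
  assert (Hw : 0 < vnorm w).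
  (* If [w] vanished, the earlier point [g u] would lie almost straight ahead along [v t], against
     [arc_past]. *)
  { destruct (Rle_lt_or_eq_dec 0 (vnorm w) (vnorm_ge0 w)) as [|E]; [easy|exfalso].
    symmetry in E. apply vnorm_eq0 in E.
    assert (E1 : inner (v t) w0 = - inner (v t) z).
    { enough (inner (v t) w = 0) by (rewrite Ew, inner_addr in H0; lra).
      rewrite E. unfold inner; simpl; ring. }
    assert (E2 : vnorm w0 = vnorm z).
    { replace w0 with (vscale (-1) z).
      - unfold vnorm; f_equal; vring.
      - rewrite E in Ew. clearbody w0 z. assert (X := f_equal fst Ew). assert (Y := f_equal snd Ew).
        simpl in X, Y. rewrite (surjective_pairing w0). unfold vscale.
        apply f_equal2; lra. }
    rewrite E1, E2 in Hp. assert (HVz : 0 < V * vnorm z) by (apply Rmult_lt_0_compat; lra).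
    assert (((1 + k) / 2 - lam) * (V * vnorm z) > 0) by (apply Rmult_lt_0_compat; lra).
    lra. }
  assert (HwG : - k * (vnorm w * vnorm z) <= inner w z).
  { assert (Hwz := vnorm_add_ge w0 z). rewrite <- Ew in Hwz.
    assert (Hz3 : k * ((vnorm w0 - vnorm z) * vnorm z) <= k * (vnorm w * vnorm z)).
    { apply Rmult_le_compat_l; [lra|]. apply Rmult_le_compat_r; lra. }
    assert (Hin : - ((lam + e) * (h * V) * vnorm w0) <= inner w0 z).
    { rewrite Ez, inner_addr, inner_scaler, (inner_comm w0 (v t)).
      assert (Hr := inner_ge w0 r).
      assert (vnorm w0 * vnorm r <= vnorm w0 * (e * V * h))
        by (apply Rmult_le_compat_l; lra).
      assert (h * (- lam * (V * vnorm w0)) <= h * inner (v t) w0)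
        by (apply Rmult_le_compat_l; lra).
      nra. }
    rewrite Ew at 2. rewrite inner_addl, <- (vnorm_sqr z).
    assert ((lam + e) * (h * V) <= k * vnorm z) by nra.
    assert (0 <= vnorm w0 * (k * vnorm z - (lam + e) * (h * V)))
      by (apply Rmult_le_pos; lra).
    nra. }
  split; [easy|]. split; [easy|].
  apply (opening_pos k ((1 + k) / 2) _ _ z); try easy; lra.
Qed.

(** * Propagation of the angle bound in time *)

(** Induction along the reals: the supremum of the times up to which [P] holds inherits [P] from the
    left, and could be exceeded if it were less than [t]. *)
Lemma interval_induction (P : R -> Prop) (s T : R) :
  (exists d, 0 < d /\ forall t, s < t < s + d -> t < T -> P t) ->
  (forall t, s < t < T -> (forall t', s < t' < t -> P t') -> P t) ->
  (forall t, s < t < T -> P t ->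
    exists d, 0 < d /\ forall t', t < t' < t + d -> t' < T -> P t') ->
  forall t, s < t < T -> P t.
Proof.
  intros [d0 [Hd0 H0]] Hclosed Hopen t Ht.
  set (E x := s < x <= t /\ forall t', s < t' < x -> P t').
  assert (HE0 : E (Rmin t (s + d0))).
  { split.
    - split; [apply Rmin_glb_lt; lra|apply Rmin_l].
    - intros t' Ht'. assert (H1 := Rmin_l t (s + d0)).
      assert (H2 := Rmin_r t (s + d0)). apply H0; lra. }
  destruct (completeness E) as [m [Hub Hlub]].
  - exists t. intros x [Hx _]. lra.
  - now exists (Rmin t (s + d0)).
  - assert (Hsm : s < m).
    { specialize (Hub _ HE0). destruct HE0 as [H1 _]. lra. }
    assert (Hmt : m <= t) by (apply Hlub; intros x [Hx _]; lra).
    assert (Hbelow : forall t', s < t' < m -> P t').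
    { intros t' Ht'. apply NNPP. intros HN.
      enough (m <= t') by lra. apply Hlub. intros x [Hx HP].
      apply Rnot_lt_le. intros Hlt. apply HN, HP. lra. }
    assert (Pm : P m) by (apply Hclosed; [lra|easy]).
    destruct (Rle_lt_or_eq_dec m t Hmt) as [Hlt|<-]; [|easy].
    exfalso. destruct (Hopen m) as [d [Hd Hr]]; [lra|easy|].
    assert (HE : E (Rmin t (m + d))).
    { split.
      - split; [apply Rmin_glb_lt; lra|apply Rmin_l].
      - intros t' Ht'. assert (H1 := Rmin_l t (m + d)).
        assert (H2 := Rmin_r t (m + d)).
        destruct (Rtotal_order t' m) as [Hl|[->|Hg]].
        + apply Hbelow; lra.
        + easy.
        + apply Hr; lra. }
    specialize (Hub _ HE). assert (m < Rmin t (m + d)) by (apply Rmin_glb_lt; lra).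
    lra.
Qed.

Lemma vsub_neq0 (p q : vec) : q <> p -> 0 < vnorm (vsub p q).
Proof.
  intros Hpq. apply vnorm_gt0. intros E. apply Hpq.
  destruct p as [x y], q as [x' y']. unfold vsub in E; simpl in E.
  injection E as E1 E2. apply f_equal2; lra.
Qed.

Lemma arc_opening (lam a b : R) (g v : R -> vec) (u t : R) : eel_arc lam a b g v ->
  a <= u <= t -> t < b -> 0 < vnorm (vsub (g t) (g u)) ->
  0 < opening (v t) (vsub (g t) (g u)).
Proof.
  intros HA Hu Ht Hw. assert (Hp := arc_past _ _ _ _ _ HA u t Hu Ht).
  assert (Hlam := arc_lam _ _ _ _ _ HA).
  assert (Hv := arc_speed _ _ _ _ _ HA t ltac:(lra)).
  unfold opening. assert (0 < vnorm (v t) * vnorm (vsub (g t) (g u))) by nra. nra.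
Qed.

Lemma arc_past_strict (lam a b k : R) (g v : R -> vec) (u t : R) :
  eel_arc lam a b g v -> lam < k ->
  a <= u <= t -> t < b -> 0 < vnorm (vsub (g t) (g u)) ->
  - k * (vnorm (v t) * vnorm (vsub (g t) (g u))) < inner (v t) (vsub (g t) (g u)).
Proof.
  intros HA Hk Hu Ht Hw. assert (Hp := arc_past _ _ _ _ _ HA u t Hu Ht).
  assert (Hv := arc_speed _ _ _ _ _ HA t ltac:(lra)).
  assert (0 < vnorm (v t) * vnorm (vsub (g t) (g u))) by nra. nra.
Qed.

(** Encodes [|f t| <= acos (- k)] for the variation [f] of the argument. The inner product bounds
    the angle modulo [2 PI]; the sign of [tri] in the frame [v t] excludes variations beyond
    [PI]. *)
Definition spread (k : R) (g v : R -> vec) (u s t : R) : Prop :=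
  0 < tri (v t) (vsub (g t) (g u)) (vsub (g t) (g s)) /\
  - k * (vnorm (vsub (g t) (g u)) * vnorm (vsub (g t) (g s)))
    <= inner (vsub (g t) (g u)) (vsub (g t) (g s)).

Lemma spread_start (lam a b k : R) (g v : R -> vec) (u s T : R) :
  eel_arc lam a b g v -> lam < k < 1 -> a <= u < s -> s < T <= b ->
  (forall t x, s < t < T -> u <= x <= s -> g x <> g t) ->
  exists d, 0 < d /\ forall t, s < t < s + d -> t < T -> spread k g v u s t.
Proof.
  intros HA Hk Hu HT Hsep.
  destruct (arc_launch lam a b k g v s HA Hk) as [d [Hd H]]; [lra|].
  exists d. split; [easy|]. intros t Ht HtT.
  destruct (H t Ht) as [Hz [Hvz Hw]]; [lra|].
  destruct (Hw u) as [Hu0 [HG _]]; [lra|]. split; [|easy].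
  assert (Hv := arc_speed _ _ _ _ _ HA s ltac:(lra)).
  assert (Cg := arc_cont _ _ _ _ _ HA).
  (* [arc_launch] controls the sign in the frame [v s]; it is then carried over to [v t]. *)
  apply (tri_frame (fun x => vsub (g t) (g x)) (v s) (v t) u s).
  - cont.
  - lra.
  - intros x Hx. apply Hw. lra.
  - intros x Hx. apply (arc_opening lam a b); try easy; try lra.
    apply vsub_neq0, Hsep; lra.
  - intros x Hx. apply Hw. lra.
  (* The lower bounds add up to [(1 - k) / 2] times the product of the norms. *)
  - assert (Hvu := inner_ge (v s) (vsub (g t) (g u))). unfold tri.
    set (V := vnorm (v s)) in *. set (W := vnorm (vsub (g t) (g u))) in *.
    set (Z := vnorm (vsub (g t) (g s))) in *.
    assert (0 < V * W * Z) by (repeat apply Rmult_lt_0_compat; easy).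
    assert (W * ((1 + k) / 2 * (V * Z)) <= W * inner (v s) (vsub (g t) (g s)))
      by (apply Rmult_le_compat_l; lra).
    assert (V * (- k * (W * Z)) <= V * inner (vsub (g t) (g u)) (vsub (g t) (g s)))
      by (apply Rmult_le_compat_l; lra).
    assert (Z * - (V * W) <= Z * inner (v s) (vsub (g t) (g u)))
      by (apply Rmult_le_compat_l; lra).
    nra.
Qed.

(** At time [t] the opening has a positive minimum over the compact [[u, s]]. Moving [g t] to [g t']
    lowers it by at most [2 |v t| |g t' - g t|], so a single [d] serves all [x]. *)
Lemma arc_opening_left (lam a b : R) (g v : R -> vec) (u s t : R) :
  eel_arc lam a b g v -> a <= u <= s -> s <= t -> t < b ->
  (forall x, u <= x <= s -> g x <> g t) ->
  exists d, 0 < d /\ forall t' x, t - d < t' <= t -> u <= x <= s ->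
    0 < opening (v t) (vsub (g t') (g x)).
Proof.
  intros HA Hu Hst Ht Hsep.
  assert (Hv := arc_speed _ _ _ _ _ HA t ltac:(lra)).
  assert (Cg := arc_cont _ _ _ _ _ HA).
  destruct (continuity_ab_min (fun x => opening (v t) (vsub (g t) (g x))) u s)
    as [y [Hmin Hy]]; [lra| |].
  { intros c _. revert c. change (continuity (fun x => opening (v t) (vsub (g t) (g x)))).
    unfold opening. cont. }
  set (m := opening (v t) (vsub (g t) (g y))) in *.
  assert (Hm : 0 < m).
  { apply (arc_opening lam a b); try easy; try lra. apply vsub_neq0, Hsep; lra. }
  destruct (continuity_pos_near
    (fun t' => m - 2 * vnorm (v t) * vnorm (vsub (g t') (g t))) t) as [d [Hd H]].
  { cont. }
  { replace (vsub (g t) (g t)) with (vscale 0 (g t))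
      by (destruct (g t); unfold vsub, vscale; simpl; f_equal; ring).
    rewrite vnorm_scale by lra. lra. }
  exists d. split; [easy|]. intros t' x Ht' Hx.
  assert (Hn := H t'). assert (Hmx := Hmin x Hx).
  assert (Hn' : 0 < m - 2 * vnorm (v t) * vnorm (vsub (g t') (g t))).
  { apply Hn. apply Rabs_def1; lra. }
  clear Hn. unfold opening in *.
  rewrite (vsub_split (g t') (g x) (g t)), inner_addr.
  assert (H1 := vnorm_add_ge (vsub (g t) (g x)) (vsub (g t') (g t))).
  assert (H2 := inner_ge (v t) (vsub (g t') (g t))).
  assert (H3 := Rmult_le_compat_l _ _ _ (Rlt_le _ _ Hv) H1). lra.
Qed.

(* The frame [v t] stays usable slightly before [t], and [tri] cannot vanish in the
   limit because no two of the three vectors are opposite. *)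
Lemma spread_left_closed (lam a b k : R) (g v : R -> vec) (u s t : R) :
  eel_arc lam a b g v -> lam < k < 1 -> a <= u < s -> s < t < b ->
  (forall t' x, s < t' <= t -> u <= x <= s -> g x <> g t') ->
  (forall t', s < t' < t -> spread k g v u s t') -> spread k g v u s t.
Proof.
  intros HA Hk Hu Ht Hsep Hbelow.
  assert (Cg := arc_cont _ _ _ _ _ HA).
  assert (Hlam := arc_lam _ _ _ _ _ HA).
  assert (Nu : 0 < vnorm (vsub (g t) (g u))) by (apply vsub_neq0, Hsep; lra).
  assert (Ns : 0 < vnorm (vsub (g t) (g s))) by (apply vsub_neq0, Hsep; lra).
  assert (HG : - k * (vnorm (vsub (g t) (g u)) * vnorm (vsub (g t) (g s)))
               <= inner (vsub (g t) (g u)) (vsub (g t) (g s))).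
  { apply Rnot_lt_le. intros HC.
    destruct (continuity_pos_near (fun t' =>
      - k * (vnorm (vsub (g t') (g u)) * vnorm (vsub (g t') (g s)))
      - inner (vsub (g t') (g u)) (vsub (g t') (g s))) t) as [d [Hd H]].
    - cont.
    - lra.
    - set (t' := t - Rmin (d / 2) ((t - s) / 2)).
      assert (H1 := Rmin_l (d / 2) ((t - s) / 2)).
      assert (H2 := Rmin_r (d / 2) ((t - s) / 2)).
      assert (H3 : 0 < Rmin (d / 2) ((t - s) / 2)) by (apply Rmin_pos; lra).
      destruct (Hbelow t') as [_ HG]; [unfold t'; lra|].
      specialize (H t'). enough (Rabs (t' - t) < d) by (specialize (H H0); lra).
      unfold t'. apply Rabs_def1; lra. }
  split; [|easy].
  assert (HN0 : tri (v t) (vsub (g t) (g u)) (vsub (g t) (g s)) <> 0).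
  { intros E. assert (S := tri_sqr (v t) (vsub (g t) (g u)) (vsub (g t) (g s))).
    rewrite E in S.
    assert (O1 := arc_opening lam a b g v u t HA ltac:(lra) ltac:(lra) Nu).
    assert (O2 := arc_opening lam a b g v s t HA ltac:(lra) ltac:(lra) Ns).
    assert (O3 : 0 < opening (vsub (g t) (g u)) (vsub (g t) (g s))).
    { unfold opening.
      assert (0 < vnorm (vsub (g t) (g u)) * vnorm (vsub (g t) (g s))) by nra. nra. }
    assert (0 < 2 * opening (v t) (vsub (g t) (g u)) * opening (v t) (vsub (g t) (g s))
      * opening (vsub (g t) (g u)) (vsub (g t) (g s)))
      by (repeat apply Rmult_lt_0_compat; lra).
    lra. }
  apply Rnot_le_lt. intros HC.
  destruct (arc_opening_left lam a b g v u s t HA) as [d1 [Hd1 Hop]]; try lra.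
  { intros x Hx. apply Hsep; lra. }
  destruct (continuity_pos_near (fun t' => 0 -
    tri (v t) (vsub (g t') (g u)) (vsub (g t') (g s))) t) as [d2 [Hd2 Htri]].
  - unfold tri. cont.
  - lra.
  - set (e := Rmin (Rmin d1 d2) (t - s)).
    assert (H0 : 0 < e) by (unfold e; repeat apply Rmin_pos; lra).
    assert (H1 : e <= d1) by (unfold e; eapply Rle_trans; apply Rmin_l).
    assert (H2 : e <= d2)
      by (unfold e; eapply Rle_trans; [apply Rmin_l|apply Rmin_r]).
    assert (H3 : e <= t - s) by apply Rmin_r.
    set (t' := t - e / 2). clearbody e.
    assert (Ht' : s < t' < t) by (unfold t'; lra).
    destruct (Hbelow t' Ht') as [HN _].
    enough (0 < tri (v t) (vsub (g t') (g u)) (vsub (g t') (g s))).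
    { specialize (Htri t'). enough (Rabs (t' - t) < d2) by (specialize (Htri H4); lra).
      unfold t'. apply Rabs_def1; lra. }
    apply (tri_frame (fun x => vsub (g t') (g x)) (v t') (v t) u s); try easy.
    + cont.
    + lra.
    + intros x Hx. apply (arc_opening lam a b); try easy; try lra.
      apply vsub_neq0, Hsep; lra.
    + intros x Hx. apply Hop; unfold t'; lra.
    + intros x Hx. apply vsub_neq0, Hsep; lra.
Qed.

(* When the angle between the two directions is extremal, the cone condition forces
   the velocity to decrease it strictly. *)
Lemma spread_right_open (lam a b k : R) (g v : R -> vec) (u s t T : R) :
  eel_arc lam a b g v -> lam < k < 1 -> a <= u < s -> s < t < T -> T <= b ->
  (forall t' x, s < t' < T -> u <= x <= s -> g x <> g t') ->
  spread k g v u s t ->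
  exists d, 0 < d /\ forall t', t < t' < t + d -> t' < T -> spread k g v u s t'.
Proof.
  intros HA Hk Hu Ht HT Hsep [HN HG].
  assert (Cg := arc_cont _ _ _ _ _ HA).
  assert (Hlam := arc_lam _ _ _ _ _ HA).
  assert (Nu : 0 < vnorm (vsub (g t) (g u))) by (apply vsub_neq0, Hsep; lra).
  assert (Ns : 0 < vnorm (vsub (g t) (g s))) by (apply vsub_neq0, Hsep; lra).
  assert (Hv := arc_speed _ _ _ _ _ HA t ltac:(lra)).
  destruct (arc_launch lam a b k g v t HA Hk) as [d1 [Hd1 Hl]]; [lra|].
  destruct (continuity_pos_near (fun t' =>
    tri (v t) (vsub (g t') (g u)) (vsub (g t') (g s))) t) as [d2 [Hd2 Htri]].
  { unfold tri. cont. }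
  { easy. }
  assert (HG' : exists d, 0 < d /\ forall t', t < t' < t + d -> t' < T ->
    - k * (vnorm (vsub (g t') (g u)) * vnorm (vsub (g t') (g s)))
    <= inner (vsub (g t') (g u)) (vsub (g t') (g s))).
  { destruct (Rle_lt_or_eq_dec _ _ HG) as [Hlt|Heq].
    - destruct (continuity_pos_near (fun t' =>
        inner (vsub (g t') (g u)) (vsub (g t') (g s))
        - - k * (vnorm (vsub (g t') (g u)) * vnorm (vsub (g t') (g s)))) t)
        as [d [Hd H]].
      + cont.
      + lra.
      + exists d. split; [easy|]. intros t' Ht' _. specialize (H t').
        enough (Rabs (t' - t) < d) by (specialize (H H0); lra).
        apply Rabs_def1; lra.
    - set (p := vsub (g t) (g u)) in *. set (q := vsub (g t) (g s)) in *.
      assert (HR : 0 < spread_rate k p q (v t)).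
      { apply spread_rate_pos; try easy; try lra;
          apply (arc_past_strict lam a b); try easy; lra. }
      (* By [spread_rate_ge] a remainder [e] costs at most [c * |e|]. The tolerance
         [spread_rate k p q (v t) / c] thus keeps the cost below the gain from moving along
         [v t]. *)
      set (c := (1 + k) * (vnorm p + vnorm q)).
      assert (Hc : 0 < c) by (unfold c; apply Rmult_lt_0_compat; lra).
      destruct (arc_step _ _ _ _ _ HA t ltac:(lra) (spread_rate k p q (v t) / c))
        as [d3 [Hd3 Hs]]; [now apply Rdiv_lt_0_compat|].
      destruct (continuity_pos_near (fun t' =>
        Rmin (vnorm p) (vnorm q) - vnorm (vsub (g t') (g t))) t) as [d4 [Hd4 Hz]].
      + cont.
      + replace (vsub (g t) (g t)) with (vscale 0 (g t))
          by (destruct (g t); unfold vsub, vscale; simpl; f_equal; ring).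
        rewrite vnorm_scale by lra.
        assert (0 < Rmin (vnorm p) (vnorm q)) by (now apply Rmin_pos). lra.
      + exists (Rmin d3 d4). split; [now apply Rmin_pos|]. intros t' Ht' HtT.
        assert (H1 := Rmin_l d3 d4). assert (H2 := Rmin_r d3 d4).
        specialize (Hs t' ltac:(lra) ltac:(lra)).
        assert (Hz' : 0 < Rmin (vnorm p) (vnorm q) - vnorm (vsub (g t') (g t))).
        { apply Hz. apply Rabs_def1; lra. }
        assert (H3 := Rmin_l (vnorm p) (vnorm q)).
        assert (H4 := Rmin_r (vnorm p) (vnorm q)).
        set (z := vsub (g t') (g t)) in *.
        rewrite (vsub_split (g t') (g u) (g t)), (vsub_split (g t') (g s) (g t)).
        fold p q z. apply spread_translate; try easy; try lra.
        set (e := vsub z (vscale (t' - t) (v t))) in *.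
        replace z with (vadd (vscale (t' - t) (v t)) e)
          by (unfold e; destruct z, (v t); unfold vadd, vsub, vscale; simpl;
              apply f_equal2; ring).
        rewrite spread_rate_linear.
        assert (He := spread_rate_ge k p q e ltac:(lra) Nu Ns). fold c in He.
        assert (Hce : c * vnorm e <= c * (spread_rate k p q (v t) / c * (t' - t)))
          by (apply Rmult_le_compat_l; lra).
        replace (c * (spread_rate k p q (v t) / c * (t' - t)))
          with ((t' - t) * spread_rate k p q (v t)) in Hce by (field; lra).
        lra. }
  destruct HG' as [d3 [Hd3 HG']].
  exists (Rmin (Rmin d1 d2) d3). split; [repeat apply Rmin_pos; easy|].
  intros t' Ht' HtT.
  assert (H1 := Rmin_l (Rmin d1 d2) d3). assert (H2 := Rmin_r (Rmin d1 d2) d3).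
  assert (H3 := Rmin_l d1 d2). assert (H4 := Rmin_r d1 d2).
  split; [|apply HG'; lra].
  destruct (Hl t') as [_ [_ Hw]]; [lra|lra|].
  apply (tri_frame (fun x => vsub (g t') (g x)) (v t) (v t') u s).
  - cont.
  - lra.
  - intros x Hx. apply Hw. lra.
  - intros x Hx. apply (arc_opening lam a b); try easy; try lra.
    apply vsub_neq0, Hsep; lra.
  - intros x Hx. apply vsub_neq0, Hsep; lra.
  - apply Htri. apply Rabs_def1; lra.
Qed.

Lemma spread_holds (lam a b k : R) (g v : R -> vec) (u s T : R) :
  eel_arc lam a b g v -> lam < k < 1 -> a <= u < s -> T <= b ->
  (forall t x, s < t < T -> u <= x <= s -> g x <> g t) ->
  forall t, s < t < T -> spread k g v u s t.
Proof.
  intros HA Hk Hu HT Hsep t Ht. revert t Ht.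
  apply interval_induction with (s := s) (T := T).
  - destruct (Rlt_le_dec s T) as [HsT|HsT].
    + apply (spread_start lam a b); try easy.
    + exists 1. split; [lra|]. intros; lra.
  - intros t Ht. apply (spread_left_closed lam a b); try easy; try lra.
    intros t' x Ht' Hx. apply Hsep; lra.
  - intros t Ht. apply (spread_right_open lam a b); try easy; lra.
Qed.

(** * Polar angles and injectivity of arcs *)

(** A relation rather than a function, so that any determination of the argument may be used. *)
Definition polar (w : vec) (A : R) : Prop :=
  w = (vnorm w * cos A, vnorm w * sin A).

Lemma polar_exists (w : vec) : 0 < vnorm w ->
  exists A, - PI < A <= PI /\ polar w A.
Proof.
  intros Hw. assert (Hsq := vnorm_sqr w). unfold inner in Hsq.
  set (X := fst w / vnorm w). set (Y := snd w / vnorm w).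
  assert (HX : fst w = vnorm w * X) by (unfold X; field; lra).
  assert (HY : snd w = vnorm w * Y) by (unfold Y; field; lra).
  assert (H1 : X * X + Y * Y = 1).
  { apply Rmult_eq_reg_l with (vnorm w * vnorm w); [|nra].
    rewrite HX, HY in Hsq at 1. nra. }
  assert (HXb : -1 <= X <= 1) by nra.
  assert (Hb := acos_bound X). assert (Hc := cos_acos X HXb).
  assert (Hs := sin_acos X HXb).
  destruct (Rle_lt_dec 0 Y) as [HY0|HY0].
  - exists (acos X). assert (HPI := PI_RGT_0). split; [lra|]. unfold polar.
    rewrite Hc, Hs. replace (1 - X²) with (Y * Y) by (unfold Rsqr; lra).
    rewrite sqrt_square, <- HX, <- HY by easy. apply surjective_pairing.
  - exists (- acos X). split.
    + assert (acos X <> PI); [|lra]. intros E. rewrite E, cos_PI in Hc. nra.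
    + unfold polar. rewrite cos_neg, sin_neg, Hc, Hs.
      replace (1 - X²) with ((- Y) * (- Y)) by (unfold Rsqr; lra).
      rewrite sqrt_square, Ropp_involutive, <- HX, <- HY by lra.
      apply surjective_pairing.
Qed.

Lemma inner_polar (p q : vec) (A B : R) : polar p A -> polar q B ->
  inner p q = vnorm p * vnorm q * cos (A - B).
Proof.
  intros Hp Hq. rewrite Hp, Hq at 1. unfold inner; simpl. rewrite cos_minus. ring.
Qed.

Lemma cos_ge_linear (x : R) : 1 - Rabs x <= cos x.
Proof.
  assert (H : forall y, 0 <= y -> 1 - y <= cos y).
  { intros y Hy. destruct (Rle_lt_or_eq_dec 0 y Hy) as [Hlt|<-].
    - destruct (MVT_cor2 cos (fun c => - sin c) 0 y Hlt) as [c [Hc _]].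
      + intros c _. apply derivable_pt_lim_cos.
      + rewrite cos_0 in Hc. assert (Hs := SIN_bound c). nra.
    - rewrite cos_0. lra. }
  unfold Rabs. destruct (Rcase_abs x) as [Hx|Hx].
  - rewrite <- cos_neg. apply H. lra.
  - apply H. lra.
Qed.

(* The limit superior of the angle is a cluster value. *)
Lemma polar_cluster (y : R -> vec) (c T : R) : c < T ->
  (forall t, c < t < T -> 0 < vnorm (y t)) ->
  exists L, forall e t0, 0 < e -> c <= t0 < T ->
    exists t A, t0 < t < T /\ polar (y t) A /\ Rabs (A - L) < e.
Proof.
  intros HcT Hy. assert (HPI := PI_RGT_0).
  set (E x := forall t0, c <= t0 < T ->
    exists t A, t0 < t < T /\ - PI < A <= PI /\ polar (y t) A /\ x <= A).
  destruct (completeness E) as [L [Hub Hlub]].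
  - exists PI. intros x Hx. destruct (Hx c) as [t [A [_ [HA [_ HxA]]]]]; lra.
  - exists (- PI). intros t0 Ht0.
    destruct (polar_exists (y ((t0 + T) / 2))) as [A [HA Hp]]; [apply Hy; lra|].
    exists ((t0 + T) / 2), A. repeat split; try easy; lra.
  - exists L. intros e t0 He Ht0.
    assert (H1 : ~ E (L + e)) by (intros H; specialize (Hub _ H); lra).
    assert (H2 : exists x, E x /\ L - e < x).
    { apply NNPP. intros HN. enough (L <= L - e) by lra. apply Hlub.
      intros x Hx. apply Rnot_lt_le. intros Hlt. apply HN. now exists x. }
    destruct H2 as [x [Hx Hlt]].
    apply not_all_ex_not in H1. destruct H1 as [t1 H1].
    apply imply_to_and in H1. destruct H1 as [Ht1 H1].
    destruct (Hx (Rmax t0 t1)) as [t [A [Ht [HA [Hp HxA]]]]].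
    { split; [apply Rle_trans with t0; [lra|apply Rmax_l]|].
      apply Rmax_lub_lt; lra. }
    assert (Hm0 := Rmax_l t0 t1). assert (Hm1 := Rmax_r t0 t1).
    exists t, A. split; [lra|]. split; [easy|].
    assert (A < L + e).
    { apply Rnot_le_lt. intros HC. apply H1. exists t, A.
      repeat split; try easy; lra. }
    apply Rabs_def1; lra.
Qed.

Lemma vnorm_sub_pos_neq (p q : vec) : 0 < vnorm (vsub p q) -> q <> p.
Proof.
  intros H ->. replace (vsub p p) with (vscale 0 p) in H
    by (destruct p; unfold vsub, vscale; simpl; apply f_equal2; ring).
  rewrite vnorm_scale in H; lra.
Qed.

(* Seen from a point close to [g p], the angle between [g p] and an earlier point
   of the arc stays away from [PI]; hence a sequence converging to [g p] fast
   enough has pairwise separated directions. *)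
Lemma arc_no_return (lam a b k : R) (g v : R -> vec) (p c T : R) :
  eel_arc lam a b g v -> lam < k < 1 -> a <= p <= c -> c < T <= b ->
  (forall t x, c < t < T -> p <= x < t -> g x <> g t) -> g p <> g T.
Proof.
  intros HA Hk Hp HT Hsep E.
  assert (Cg := arc_cont _ _ _ _ _ HA). assert (Hlam := arc_lam _ _ _ _ _ HA).
  set (y t := vsub (g t) (g p)).
  assert (Hy : forall t, c < t < T -> 0 < vnorm (y t)).
  { intros t Ht. apply vsub_neq0, Hsep; lra. }
  (* When [y t] is short compared with [y s], this bounds the cosine between their directions by
     about [k]. *)
  assert (Hang : forall s t, c < s < T -> s < t < T ->
    inner (y t) (y s) <= vnorm (y t) * (vnorm (y t) + k * (vnorm (y t) + vnorm (y s)))).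
  { intros s t Hs Ht.
    destruct (spread_holds lam a b k g v p s T HA Hk) with (t := t) as [_ HG];
      try easy; try lra.
    { intros t' x Ht' Hx. apply Hsep; lra. }
    fold (y t) in HG.
    assert (Ew : vsub (g t) (g s) = vadd (y t) (vscale (-1) (y s))).
    { unfold y. destruct (g t), (g s), (g p). unfold vadd, vsub, vscale; simpl.
      apply f_equal2; ring. }
    rewrite Ew, inner_addr, inner_scaler, <- vnorm_sqr in HG.
    assert (Hn := vnorm_add_le (y t) (vscale (-1) (y s))).
    replace (vnorm (vscale (-1) (y s))) with (vnorm (y s)) in Hn
      by (unfold vnorm; f_equal; unfold inner, vscale; simpl; ring).
    assert (Hyt := Hy t ltac:(lra)).
    assert (k * (vnorm (y t) * vnorm (vadd (y t) (vscale (-1) (y s))))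
            <= k * (vnorm (y t) * (vnorm (y t) + vnorm (y s)))).
    { apply Rmult_le_compat_l; [lra|]. apply Rmult_le_compat_l; lra. }
    nra. }
  destruct (polar_cluster y c T) as [L HL]; [lra|easy|].
  (* Two directions within [2 e] and [|y t| < e |y s|] would give [1 - 2 e <= e + k (1 + e)], hence
     [1 - k < 4 e = (1 - k) / 2]. *)
  set (e := (1 - k) / 8). assert (He : 0 < e) by (unfold e; lra).
  destruct (HL e c He) as [s [A [Hs [HpA HAL]]]]; [lra|].
  assert (Hys := Hy s ltac:(lra)).
  destruct (continuity_pos_near (fun t => e * vnorm (y s) - vnorm (y t)) T)
    as [d [Hd Hnear]].
  { unfold y. cont. }
  { unfold y at 2. rewrite E. replace (vsub (g T) (g T)) with (vscale 0 (g T))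
      by (destruct (g T); unfold vsub, vscale; simpl; apply f_equal2; ring).
    rewrite vnorm_scale by lra. nra. }
  destruct (HL e (Rmax s (T - d)) He) as [t [B [Ht [HpB HBL]]]].
  { split; [apply Rle_trans with s; [lra|apply Rmax_l]|apply Rmax_lub_lt; lra]. }
  assert (Hm1 := Rmax_l s (T - d)). assert (Hm2 := Rmax_r s (T - d)).
  assert (Hyt := Hy t ltac:(lra)).
  assert (Hsm : 0 < e * vnorm (y s) - vnorm (y t)).
  { apply Hnear. apply Rabs_def1; lra. }
  specialize (Hang s t ltac:(lra) ltac:(lra)).
  rewrite (inner_polar _ _ B A HpB HpA) in Hang.
  assert (Hcos := cos_ge_linear (B - A)).
  assert (HBA : Rabs (B - A) < 2 * e).
  { apply Rabs_def2 in HAL. apply Rabs_def2 in HBL. apply Rabs_def1; lra. }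
  assert (Hc : 1 - 2 * e <= cos (B - A)) by lra.
  assert (Hc' : vnorm (y s) * cos (B - A)
                <= vnorm (y t) + k * (vnorm (y t) + vnorm (y s))).
  { apply Rmult_le_reg_l with (vnorm (y t)); [easy|]. lra. }
  assert (vnorm (y s) * (1 - 2 * e) <= vnorm (y s) * cos (B - A))
    by (apply Rmult_le_compat_l; lra).
  unfold e in *. nra.
Qed.

(** Let [z] be the infimum of the [w n]; every [m n] is at most [z]. By [arc_launch] the points just
    after [z] avoid the whole past up to [z], but [g (w n)] is such a past point. *)
Lemma decreasing_loops_absurd (lam a b : R) (g v : R -> vec) (m w : nat -> R) :
  eel_arc lam a b g v ->
  (forall n, a <= m n < w n /\ w n <= b /\
     exists u, a <= u <= m n /\ g u = g (w n)) ->
  (forall n, m n <= m (S n)) -> (forall n, w (S n) < w n) -> False.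
Proof.
  intros HA Hmw Hm Hw.
  assert (Hlam := arc_lam _ _ _ _ _ HA).
  assert (Hmm : forall n j, m n <= m (n + j)%nat).
  { intros n j. induction j as [|j IH]; [rewrite Nat.add_0_r; lra|].
    rewrite Nat.add_succ_r. specialize (Hm (n + j)%nat). lra. }
  assert (Hww : forall n j, w (n + j)%nat <= w n).
  { intros n j. induction j as [|j IH]; [rewrite Nat.add_0_r; lra|].
    rewrite Nat.add_succ_r. specialize (Hw (n + j)%nat). lra. }
  assert (Hlt : forall n j, m n < w j).
  { intros n j. assert (H1 := Hmm n j). assert (H2 := Hww j n).
    destruct (Hmw (n + j)%nat) as [H3 _]. rewrite Nat.add_comm in H2. lra. }
  destruct (completeness (fun x => forall n, x <= w n)) as [z [Hub Hlub]].
  - exists (w O). intros x Hx. apply Hx.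
  - exists (m O). intros n. specialize (Hlt O n). lra.
  - assert (Hzw : forall n, z < w n).
    { intros n. apply Rle_lt_trans with (w (S n)); [|apply Hw].
      apply Hlub. intros x Hx. apply Hx. }
    assert (Hmz : forall n, m n <= z).
    { intros n. apply Hub. intros j. specialize (Hlt n j). lra. }
    assert (Hz : a <= z < b).
    { destruct (Hmw O) as [H1 [H2 _]]. specialize (Hmz O). specialize (Hzw O). lra. }
    destruct (arc_launch lam a b ((1 + lam) / 2) g v z HA) as [d [Hd H]]; [lra|easy|].
    assert (Hn : exists n, w n < z + d).
    { apply NNPP. intros HN. enough (z + d <= z) by lra. apply Hub.
      intros n. apply Rnot_lt_le. intros Hn. apply HN. now exists n. }
    destruct Hn as [n Hn]. destruct (Hmw n) as [_ [Hwb [u [Hu E]]]].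
    specialize (Hmz n). specialize (Hzw n).
    destruct (H (w n) ltac:(lra) Hwb) as [_ [_ Hs]].
    destruct (Hs u ltac:(lra)) as [Hpos _].
    now apply (vnorm_sub_pos_neq _ _ Hpos).
Qed.

(* If the arc had a loop, then every loop [u, w] would contain the end [w'] of
   another one, with [u < w' < w], and iterating would contradict
   [decreasing_loops_absurd]. *)
Lemma arc_injective (lam a b : R) (g v : R -> vec) (u w : R) :
  eel_arc lam a b g v -> a <= u < w -> w <= b -> g u <> g w.
Proof.
  intros HA Hu Hw E.
  assert (Hlam := arc_lam _ _ _ _ _ HA).
  (* The first component only bounds the start of the loop from above, so it can be kept
     nondecreasing by taking a maximum. *)
  set (Q (st : R * R) := a <= fst st < snd st /\ snd st <= b /\
    exists u, a <= u <= fst st /\ g u = g (snd st)).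
  assert (Hstep : forall st, exists st', Q st ->
    Q st' /\ fst st <= fst st' /\ snd st' < snd st).
  { intros [m x]. destruct (classic (Q (m, x))) as [HQ|HQ]; [|now exists (m, x)].
    destruct HQ as [H1 [H2 [p [Hp Ep]]]]; simpl in *.
    apply NNPP. intros HN.
    refine (arc_no_return lam a b ((1 + lam) / 2) g v p m x HA _ _ _ _ Ep); try lra.
    intros t y Ht Hy Ey. apply HN. exists (Rmax m y, t). intros _. simpl.
    assert (Hl := Rmax_l m y). assert (Hr := Rmax_r m y).
    assert (Hlt : Rmax m y < t) by (apply Rmax_lub_lt; lra).
    repeat split; simpl; try lra. exists y. split; [lra|easy]. }
  apply functional_choice in Hstep. destruct Hstep as [f Hf].
  set (st := fix st n := match n with O => (u, w) | S n => f (st n) end).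
  assert (HQ : forall n, Q (st n)).
  { induction n as [|n IH]; simpl.
    - repeat split; simpl; try lra. exists u. split; [lra|easy].
    - now apply Hf. }
  apply (decreasing_loops_absurd lam a b g v (fun n => fst (st n)) (fun n => snd (st n)));
    try easy; intros n; now apply Hf.
Qed.

(** * The sector containing the velocity and the directions from the past *)

Lemma polar_turn (w : vec) (A : R) : polar w A -> polar w (A + 2 * PI).
Proof. unfold polar. now rewrite cos_plus, sin_plus, cos_2PI, sin_2PI, !Rmult_0_r,
  !Rmult_1_r, Rminus_0_r, Rplus_0_r. Qed.

Lemma polar_turn_back (w : vec) (A : R) : polar w A -> polar w (A - 2 * PI).
Proof. unfold polar. now rewrite cos_minus, sin_minus, cos_2PI, sin_2PI, !Rmult_0_r,
  !Rmult_1_r, Rminus_0_r, Rplus_0_r. Qed.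

(** Since [w] is not opposite to [v], its angle relative to [v] has a determination in the open
    interval. *)
Lemma polar_relative (v w : vec) (B : R) : polar v B -> 0 < vnorm v ->
  0 < opening v w -> 0 < vnorm w -> - PI < B <= PI ->
  exists A, - PI < A < PI /\ polar w (B + A).
Proof.
  intros Hv Nv Ho Nw HB. assert (HPI := PI_RGT_0).
  destruct (polar_exists w Nw) as [C [HC Hw]].
  assert (HA : exists A, - PI < A <= PI /\ polar w (B + A)).
  { destruct (Rle_lt_dec (C - B) (- PI)) as [H1|H1];
      [|destruct (Rle_lt_dec (C - B) PI) as [H2|H2]].
    - exists (C - B + 2 * PI). split; [lra|].
      replace (B + (C - B + 2 * PI)) with (C + 2 * PI) by ring. now apply polar_turn.
    - exists (C - B). split; [lra|]. now replace (B + (C - B)) with C by ring.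
    - exists (C - B - 2 * PI). split; [lra|].
      replace (B + (C - B - 2 * PI)) with (C - 2 * PI) by ring.
      now apply polar_turn_back. }
  destruct HA as [A [HA Hp]]. exists A. split; [|easy]. split; [easy|].
  destruct (Rle_lt_or_eq_dec A PI) as [|E]; [easy|easy|exfalso].
  unfold opening in Ho. rewrite (inner_polar v w B (B + A) Hv Hp) in Ho.
  replace (B - (B + A)) with (- A) in Ho by ring.
  rewrite cos_neg, E, cos_PI in Ho. lra.
Qed.

(** The sum equals [4 cos (A / 2) cos (B / 2) cos ((A - B) / 2)], whose first two cosines are
    positive. Hence [A - B] cannot exceed [PI], and on [[0, PI]] the cosine is decreasing. *)
Lemma angle_gap (k A B : R) : -1 <= - k <= 1 -> - PI < A < PI -> - PI < B < PI ->
  - k <= cos (A - B) -> 0 < 1 + cos A + cos B + cos (A - B) ->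
  A - B <= acos (- k).
Proof.
  intros Hk HA HB HG HN. assert (HPI := PI_RGT_0). assert (Hb := acos_bound (- k)).
  destruct (Rle_lt_dec (A - B) 0) as [H0|H0]; [lra|].
  destruct (Rle_lt_dec (A - B) PI) as [H1|H1].
  - apply cos_decr_0; try lra. now rewrite cos_acos.
  - exfalso. set (x := A / 2). set (y := B / 2).
    assert (E : 1 + cos A + cos B + cos (A - B) = 4 * (cos x * cos y * cos (x - y))).
    { replace A with (2 * x) by (unfold x; field).
      replace B with (2 * y) by (unfold y; field).
      replace (2 * x - 2 * y) with (2 * (x - y)) by ring.
      rewrite !cos_2a_cos, cos_minus.
      assert (Sx := sin2_cos2 x). assert (Sy := sin2_cos2 y). unfold Rsqr in *.
      nsatz. }
    assert (Cx : 0 < cos x) by (apply cos_gt_0; unfold x; lra).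
    assert (Cy : 0 < cos y) by (apply cos_gt_0; unfold y; lra).
    assert (Cxy : cos (x - y) < 0) by (apply cos_lt_0; unfold x, y; lra).
    assert (0 < cos x * cos y) by nra. nra.
Qed.

Lemma tri_comm (v p q : vec) : tri v p q = tri v q p.
Proof. unfold tri. rewrite (inner_comm p q). ring. Qed.

Lemma spread_angle (k : R) (v p q : vec) (C A B : R) : 0 <= k < 1 ->
  0 < vnorm v -> 0 < vnorm p -> 0 < vnorm q ->
  polar v C -> polar p (C + A) -> polar q (C + B) ->
  - PI < A < PI -> - PI < B < PI ->
  0 < tri v p q -> - k * (vnorm p * vnorm q) <= inner p q ->
  A - B <= acos (- k).
Proof.
  intros Hk Nv Np Nq Pv Pp Pq HA HB HN HG.
  apply angle_gap; try easy; try lra.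
  - rewrite (inner_polar _ _ _ _ Pp Pq) in HG.
    replace (C + A - (C + B)) with (A - B) in HG by ring.
    apply Rmult_le_reg_l with (vnorm p * vnorm q); [nra|lra].
  - unfold tri in HN.
    rewrite (inner_polar _ _ _ _ Pp Pq), (inner_polar _ _ _ _ Pv Pq),
      (inner_polar _ _ _ _ Pv Pp) in HN.
    replace (C + A - (C + B)) with (A - B) in HN by ring.
    replace (C - (C + A)) with (- A) in HN by ring.
    replace (C - (C + B)) with (- B) in HN by ring.
    rewrite !cos_neg in HN.
    apply Rmult_lt_reg_l with (vnorm v * vnorm p * vnorm q); [|lra].
    repeat apply Rmult_lt_0_compat; easy.
Qed.

(* The velocity and all directions from earlier points are pairwise at most
   [acos (- k)] apart as angles, not just modulo [2 * PI], so they fit in a sector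
   of that aperture. *)
Lemma arc_in_cone (lam a b k : R) (g v : R -> vec) (t : R) : eel_arc lam a b g v ->
  lam < k < 1 -> a <= t < b ->
  exists C, - (2 * PI) <= C <= 2 * PI /\
    (exists A, polar (v t) A /\ Rabs (A - C) <= acos (- k) / 2) /\
    forall u, a <= u < t ->
      exists A, polar (vsub (g t) (g u)) A /\ Rabs (A - C) <= acos (- k) / 2.
Proof.
  intros HA Hk Ht. assert (HPI := PI_RGT_0).
  assert (Hlam := arc_lam _ _ _ _ _ HA). assert (Hb := acos_bound (- k)).
  assert (Nv := arc_speed _ _ _ _ _ HA t Ht).
  assert (Nw : forall u, a <= u < t -> 0 < vnorm (vsub (g t) (g u))).
  { intros u Hu. apply vsub_neq0, (arc_injective lam a b g v); try easy; lra. }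
  assert (Ho : forall u, a <= u < t -> 0 < opening (v t) (vsub (g t) (g u))).
  { intros u Hu. apply (arc_opening lam a b); try easy; try lra. now apply Nw. }
  assert (Hs : forall u s, a <= u < t -> a <= s < t -> spread k g v u s t).
  { assert (Hlt : forall u s, a <= u < s -> s < t -> spread k g v u s t).
    { intros u s Hu Hst. apply (spread_holds lam a b k g v u s b); try easy; try lra.
      intros t' x Ht' Hx. apply (arc_injective lam a b g v); try easy; lra. }
    intros u s Hu Hst. destruct (Rtotal_order u s) as [H|[->|H]].
    - apply Hlt; lra.
    - split.
      + rewrite tri_self. specialize (Nw s Hst). specialize (Ho s Hst). nra.
      + rewrite <- vnorm_sqr. nra.
    - destruct (Hlt s u) as [H1 H2]; try lra. split.
      + now rewrite tri_comm.
      + rewrite inner_comm, (Rmult_comm (vnorm _) (vnorm _)). exact H2. }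
  destruct (polar_exists (v t) Nv) as [B [HB Pv]].
  (* Angles are measured from the velocity, which is itself represented by [0]. *)
  set (E A := - PI < A < PI /\
    (A = 0 \/ exists u, a <= u < t /\ polar (vsub (g t) (g u)) (B + A))).
  assert (HE : forall A A', E A -> E A' -> A - A' <= acos (- k)).
  { assert (Hcos : forall A u, a <= u < t -> polar (vsub (g t) (g u)) (B + A) ->
      - k < cos A).
    { intros A u Hu Pw.
      assert (Hp := arc_past_strict lam a b k g v u t HA ltac:(lra) ltac:(lra)
        ltac:(lra) (Nw u Hu)).
      rewrite (inner_polar _ _ _ _ Pv Pw) in Hp.
      replace (B - (B + A)) with (- A) in Hp by ring. rewrite cos_neg in Hp.
      specialize (Nw u Hu).
      apply Rmult_lt_reg_l with (vnorm (v t) * vnorm (vsub (g t) (g u))); [nra|lra]. }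
    intros A A' [H1 [-> | [u [Hu Pu]]]] [H2 [-> | [s [Hst Ps]]]].
    - lra.
    - specialize (Hcos A' s Hst Ps). apply angle_gap; try easy; try lra;
        rewrite Rminus_0_l, cos_neg; try rewrite cos_0; lra.
    - specialize (Hcos A u Hu Pu). apply angle_gap; try easy; try lra;
        rewrite Rminus_0_r; try rewrite cos_0; lra.
    - destruct (Hs u s Hu Hst) as [HN HG].
      apply (spread_angle k (v t) (vsub (g t) (g u)) (vsub (g t) (g s)) B);
        try easy; try lra; now apply Nw. }
  assert (HE0 : E 0) by (split; [lra|now left]).
  destruct (completeness E) as [M [Hub Hlub]].
  { exists PI. intros x [Hx _]. lra. }
  { now exists 0. }
  assert (HM : forall A, E A -> M - acos (- k) <= A <= M).
  { intros A HEA. split; [|now apply Hub].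
    enough (M <= A + acos (- k)) by lra. apply Hlub. intros x Hx.
    specialize (HE x A Hx HEA). lra. }
  (* Midpoint of the sector [[M - acos (- k), M]], shifted by the angle [B] of the velocity. *)
  exists (B + M - acos (- k) / 2). split; [|split].
  - assert (HM0 := HM 0 HE0).
    assert (M <= PI) by (apply Hlub; intros x [Hx _]; lra). lra.
  - exists B. split; [easy|]. specialize (HM 0 HE0). apply Rabs_le. lra.
  - intros u Hu.
    destruct (polar_relative (v t) (vsub (g t) (g u)) B) as [A [HAb Pw]]; try easy;
      try now (apply Ho || apply Nw).
    exists (B + A). split; [easy|].
    assert (HEA : E A) by (split; [easy|right; now exists u]).
    specialize (HM A HEA). apply Rabs_le. lra.
Qed.

(** * Support functions and domination of length *)

Definition dir (A : R) : vec := (cos A, sin A).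

Lemma inner_dir (w : vec) (A B : R) : polar w A ->
  inner w (dir B) = vnorm w * cos (A - B).
Proof.
  intros Hw. rewrite Hw at 1. unfold inner, dir; simpl. rewrite cos_minus. ring.
Qed.

Lemma vnorm_dir (A : R) : vnorm (dir A) = 1.
Proof.
  unfold vnorm, inner, dir; simpl. assert (H := sin2_cos2 A). unfold Rsqr in H.
  rewrite <- sqrt_1. f_equal. lra.
Qed.

Lemma cos_ge_of_Rabs (x y : R) : Rabs x <= y -> y <= PI -> cos y <= cos x.
Proof.
  intros Hx Hy. assert (H0 := Rabs_pos x).
  replace (cos x) with (cos (Rabs x)).
  - apply cos_decr_1; lra.
  - unfold Rabs. destruct (Rcase_abs x); [apply cos_neg|easy].
Qed.

(** A direction this close to the axis of the sector makes with each of its vectors an angle of at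
    most [acos (- k) / 2 + (PI - acos (- k)) / 4 = (PI + acos (- k)) / 4 < PI / 2]. *)
Lemma arc_escapes (lam a b k : R) (g v : R -> vec) (t : R) : eel_arc lam a b g v ->
  lam < k < 1 -> a <= t < b ->
  exists C, - (2 * PI) <= C <= 2 * PI /\
    forall B, Rabs (B - C) <= (PI - acos (- k)) / 4 ->
      vnorm (v t) * cos ((PI + acos (- k)) / 4) <= inner (v t) (dir B) /\
      forall u, a <= u <= t -> inner (g u) (dir B) <= inner (g t) (dir B).
Proof.
  intros HA Hk Ht. assert (HPI := PI_RGT_0).
  assert (Hlam := arc_lam _ _ _ _ _ HA).
  assert (Hb := acos_bound_lt (- k) ltac:(lra)).
  destruct (arc_in_cone lam a b k g v t HA Hk Ht) as [C [HC [[A [Pv HAC]] Hw]]].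
  exists C. split; [easy|]. intros B HB.
  assert (Hcos : forall A', Rabs (A' - C) <= acos (- k) / 2 ->
    cos ((PI + acos (- k)) / 4) <= cos (A' - B)).
  { intros A' HA'. apply cos_ge_of_Rabs; [|lra].
    replace (A' - B) with ((A' - C) + (C - B)) by ring.
    eapply Rle_trans; [apply Rabs_triang|]. rewrite (Rabs_minus_sym C B). lra. }
  assert (H0 : 0 < cos ((PI + acos (- k)) / 4)) by (apply cos_gt_0; lra).
  split.
  - rewrite (inner_dir _ A) by easy. apply Rmult_le_compat_l; [apply vnorm_ge0|].
    now apply Hcos.
  - intros u Hu. destruct (Rle_lt_or_eq_dec u t) as [Hlt | ->]; [easy| |lra].
    destruct (Hw u ltac:(lra)) as [A' [Pw HA']].
    assert (Hin := inner_dir _ A' B Pw). assert (Hn := vnorm_ge0 (vsub (g t) (g u))).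
    specialize (Hcos A' HA').
    assert (0 <= inner (vsub (g t) (g u)) (dir B)) by (rewrite Hin; nra).
    unfold inner, vsub in *; simpl in *. lra.
Qed.

Lemma grid_point (x e : R) (n : nat) : 0 <= x <= INR n * e -> 0 < e ->
  exists j, (j <= n)%nat /\ Rabs (INR j * e - x) <= e.
Proof.
  intros Hx He. induction n as [|n IH].
  - exists O. split; [lia|]. simpl in *. apply Rabs_le. lra.
  - destruct (Rle_lt_dec x (INR n * e)) as [H|H].
    + destruct IH as [j [Hj HR]]; [lra|]. exists j. split; [lia|easy].
    + exists n. split; [lia|]. rewrite S_INR in Hx. apply Rabs_le. lra.
Qed.

(** Support function, in direction [n], of the convex hull of the past up to time [t]. *)
Definition is_support (a : R) (g : R -> vec) (n : vec) (t h : R) : Prop :=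
  is_lub (fun x => exists u, a <= u <= t /\ x = inner (g u) n) h.

Lemma support_exists (a b M : R) (g : R -> vec) :
  (forall t, a <= t <= b -> vnorm (g t) <= M) ->
  exists H : vec -> R -> R, forall n t, a <= t <= b -> is_support a g n t (H n t).
Proof.
  intros HM.
  destruct (functional_choice
    (fun (q : vec * R) h => a <= snd q <= b -> is_support a g (fst q) (snd q) h))
    as [H HH].
  - intros [n t]; simpl. destruct (classic (a <= t <= b)) as [Ht|Ht].
    + destruct (completeness (fun x => exists u, a <= u <= t /\ x = inner (g u) n))
        as [h Hh].
      * exists (M * vnorm n). intros x [u [Hu ->]].
        eapply Rle_trans; [apply inner_le|].
        apply Rmult_le_compat_r; [apply vnorm_ge0|apply HM; lra].
      * exists (inner (g a) n). exists a. split; [lra|easy].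
      * now exists h.
    + now exists 0.
  - exists (fun n t => H (n, t)). intros n t. apply (HH (n, t)).
Qed.

Lemma sum_diff_ge (f h : nat -> R) (n j : nat) :
  (forall i, (i <= n)%nat -> f i <= h i) -> (j <= n)%nat ->
  h j - f j <= sum_f_R0 h n - sum_f_R0 f n.
Proof.
  induction n as [|n IH]; intros Hfh Hj; simpl.
  - replace j with O by lia. lra.
  - assert (Hn := Hfh (S n) (le_n _)).
    assert (H0 : forall i, (i <= n)%nat -> f i <= h i) by (intros i Hi; apply Hfh; lia).
    destruct (Nat.eq_dec j (S n)) as [->|Hne].
    + assert (H1 := sum_Rle f h n H0). lra.
    + specialize (IH H0 ltac:(lia)). lra.
Qed.

(* At each time the arc leaves the current hull through one of finitely many
   directions, so the sum of the corresponding support functions controls it. *)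
Lemma arc_dominated (lam M : R) : 0 <= lam < 1 -> 0 <= M ->
  exists K, 0 <= K /\ forall a b g v, eel_arc lam a b g v ->
    (forall t, a <= t <= b -> vnorm (g t) <= M) ->
    exists F : R -> R,
      (forall s t, a <= s < t -> t <= b -> vnorm (vsub (g t) (g s)) <= F t - F s) /\
      (forall s t, a <= s <= b -> a <= t <= b -> F t - F s <= K).
Proof.
  intros Hlam HM0. assert (HPI := PI_RGT_0).
  set (k := (1 + lam) / 2). assert (Hk : lam < k < 1) by (unfold k; lra).
  assert (Hb := acos_bound_lt (- k) ltac:(lra)).
  set (e := (PI - acos (- k)) / 4). assert (He : 0 < e) by (unfold e; lra).
  set (c := cos ((PI + acos (- k)) / 4)).
  assert (Hc : 0 < c) by (apply cos_gt_0; lra).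
  assert (Hc1 : c <= 1) by apply COS_bound.
  destruct (archimed_cor1 (e / (4 * PI))) as [N [HN HN0]].
  { apply Rdiv_lt_0_compat; lra. }
  assert (HNR : 0 < INR N) by (now apply lt_0_INR).
  assert (HNe : 4 * PI <= INR N * e).
  { apply Rmult_lt_compat_l with (r := INR N * (4 * PI)) in HN; [|nra].
    replace (INR N * (4 * PI) * / INR N) with (4 * PI) in HN by (field; lra).
    replace (INR N * (4 * PI) * (e / (4 * PI))) with (INR N * e) in HN by (field; lra).
    lra. }
  (* The grid has mesh [e] and covers [[- 2 PI, 2 PI]], where the sector axes lie. *)
  set (n j := dir (- (2 * PI) + INR j * e)).
  (* Each of the [N + 1] support functions stays in [[- M, M]]. Over a short step [h] the curve
     moves at most [2 h |v|] while one of them grows by at least [c / 2 * h |v|], whence the factor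
     [4 / c]. *)
  exists (4 / c * (2 * M * INR (S N))).
  assert (Hfc : 0 < 4 / c) by (apply Rdiv_lt_0_compat; lra).
  split.
  { assert (HSN := pos_INR (S N)). repeat apply Rmult_le_pos; lra. }
  intros a b g v HA HgM.
  destruct (support_exists a b M g HgM) as [H HH].
  set (F t := 4 / c * sum_f_R0 (fun j => H (n j) t) N).
  assert (Hge : forall j u t, a <= u <= t -> t <= b -> inner (g u) (n j) <= H (n j) t).
  { intros j u t Hu Ht. apply (HH (n j) t); [lra|]. now exists u. }
  assert (Hmono : forall j s t, a <= s <= t -> t <= b -> H (n j) s <= H (n j) t).
  { intros j s t Hs Ht. apply (HH (n j) s); [lra|]. intros x [u [Hu ->]].
    apply Hge; lra. }
  assert (HFmono : forall s t, a <= s <= t -> t <= b -> F s <= F t).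
  { intros s t Hs Ht. unfold F. apply Rmult_le_compat_l; [lra|].
    apply sum_Rle. intros j _. now apply Hmono. }
  assert (Hgrow : forall t, a <= t < b -> exists d, 0 < d /\
    forall t', t < t' < t + d -> t' <= b -> vnorm (vsub (g t') (g t)) <= F t' - F t).
  { intros t Ht.
    destruct (arc_escapes lam a b k g v t HA Hk Ht) as [C [HC HB]].
    destruct (grid_point (C + 2 * PI) e N) as [j [Hj HjC]]; [lra|easy|].
    destruct (HB (- (2 * PI) + INR j * e)) as [Hv Hmax].
    { replace (- (2 * PI) + INR j * e - C) with (INR j * e - (C + 2 * PI)) by ring.
      exact HjC. }
    fold (n j) in Hv, Hmax. fold c in Hv.
    assert (Nv := arc_speed _ _ _ _ _ HA t Ht).
    destruct (arc_step _ _ _ _ _ HA t Ht (c * vnorm (v t) / 2)) as [d [Hd Hs]]; [nra|].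
    exists d. split; [easy|]. intros t' Ht' Htb. specialize (Hs t' Ht' Htb).
    (* The current point attains the support value in this direction, so any advance along it is
       growth of [H]. *)
    assert (HHt : H (n j) t <= inner (g t) (n j)).
    { apply (HH (n j) t); [lra|]. intros x [u [Hu ->]]. now apply Hmax. }
    assert (HHt' := Hge j t' t' ltac:(lra) Htb).
    assert (Hsum := sum_diff_ge (fun j => H (n j) t) (fun j => H (n j) t') N j
      ltac:(intros i _; apply Hmono; lra) Hj). simpl in Hsum.
    set (z := vsub (g t') (g t)) in *. set (h := t' - t) in *.
    assert (Hh : 0 < h) by (unfold h; lra).
    set (r := vsub z (vscale h (v t))) in *.
    assert (Ez : z = vadd (vscale h (v t)) r).
    { unfold r. destruct z, (v t); unfold vadd, vsub, vscale; simpl.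
      apply f_equal2; ring. }
    assert (Hz : vnorm z <= h * vnorm (v t) + vnorm r).
    { rewrite Ez, <- (vnorm_scale h) by lra. apply vnorm_add_le. }
    assert (Hzn : h * inner (v t) (n j) - vnorm r <= inner z (n j)).
    { rewrite Ez, inner_addl, inner_scalel. assert (Hr := inner_ge r (n j)).
      unfold n in Hr at 1. rewrite vnorm_dir in Hr. lra. }
    assert (Hzg : inner z (n j) = inner (g t') (n j) - inner (g t) (n j))
      by (unfold z, inner, vsub; simpl; ring).
    assert (HhV : 0 < h * vnorm (v t)) by nra.
    assert (h * (vnorm (v t) * c) <= h * inner (v t) (n j))
      by (apply Rmult_le_compat_l; lra).
    assert (Hlow : c / 2 * (h * vnorm (v t)) <= inner z (n j)) by lra.
    assert (Hup : vnorm z <= 2 * (h * vnorm (v t))) by nra.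
    unfold F. rewrite <- Rmult_minus_distr_l.
    apply Rle_trans with (4 / c * inner z (n j)).
    - apply Rle_trans with (4 / c * (c / 2 * (h * vnorm (v t)))).
      + replace (4 / c * (c / 2 * (h * vnorm (v t)))) with (2 * (h * vnorm (v t)))
          by (field; lra). easy.
      + apply Rmult_le_compat_l; lra.
    - apply Rmult_le_compat_l; lra. }
  exists F. split.
  - intros s t Hs Htb.
    assert (Cg := arc_cont _ _ _ _ _ HA).
    (* The induction runs over an open interval, extended past [b] so that [t' = b] is included. *)
    enough (HP : forall t', s < t' < b + 1 -> t' <= b ->
      vnorm (vsub (g t') (g s)) <= F t' - F s) by (apply HP; lra).
    apply (interval_induction
      (fun t' => t' <= b -> vnorm (vsub (g t') (g s)) <= F t' - F s)).
    + destruct (Hgrow s) as [d [Hd Hs']]; [lra|]. exists d. split; [easy|].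
      intros t' Ht' _. now apply Hs'.
    (* Continuity of [g] and monotonicity of [F] suffice here; [F] may jump. *)
    + intros x Hx Hbelow Hxb. apply Rnot_lt_le. intros HC.
      destruct (continuity_pos_near
        (fun t' => vnorm (vsub (g t') (g s)) - (F x - F s)) x) as [d [Hd Hn]].
      * cont.
      * lra.
      * set (e' := Rmin d (x - s)). assert (He' : 0 < e') by (apply Rmin_pos; lra).
        assert (H1 : e' <= d) by apply Rmin_l.
        assert (H2 : e' <= x - s) by apply Rmin_r. clearbody e'.
        specialize (Hbelow (x - e' / 2) ltac:(lra) ltac:(lra)).
        specialize (HFmono (x - e' / 2) x ltac:(lra) Hxb).
        specialize (Hn (x - e' / 2)).
        enough (Rabs (x - e' / 2 - x) < d) by (specialize (Hn H0); lra).
        apply Rabs_def1; lra.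
    + intros x Hx Px. destruct (Rlt_le_dec x b) as [Hxb|Hxb].
      * destruct (Hgrow x) as [d [Hd Hx']]; [lra|]. exists d. split; [easy|].
        intros t' Ht' _ Htb'. specialize (Px ltac:(lra)). specialize (Hx' t' Ht' Htb').
        rewrite (vsub_split (g t') (g s) (g x)).
        eapply Rle_trans; [apply vnorm_add_le|]. lra.
      * exists 1. split; [lra|]. intros; lra.
  - intros s t Hs Ht. unfold F. rewrite <- Rmult_minus_distr_l.
    apply Rmult_le_compat_l; [lra|].
    assert (Hin : forall u j, a <= u <= b -> - M <= inner (g u) (n j) <= M).
    { intros u j Hu. specialize (HgM u Hu).
      assert (H1 := inner_ge (g u) (n j)). assert (H2 := inner_le (g u) (n j)).
      unfold n in H1 at 1, H2 at 2. rewrite vnorm_dir in H1, H2. lra. }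
    assert (Ut : sum_f_R0 (fun j => H (n j) t) N <= sum_f_R0 (fun _ => M) N).
    { apply sum_Rle. intros j _. apply (HH (n j) t Ht). intros x [u [Hu ->]].
      apply Hin; lra. }
    assert (Us : sum_f_R0 (fun _ => - M) N <= sum_f_R0 (fun j => H (n j) s) N).
    { apply sum_Rle. intros j _. eapply Rle_trans; [apply (Hin s j); lra|].
      apply Hge; lra. }
    rewrite sum_cte in Ut, Us. lra.
Qed.

(** The increments of [F] telescope; [t2] is the last point of the list. *)
Lemma poly_len_dominated (g : R -> vec) (F : R -> R) (a b : R) (ts : list R) :
  (forall s t, a <= s < t -> t <= b -> vnorm (vsub (g t) (g s)) <= F t - F s) ->
  forall t1, Sorted Rlt (t1 :: ts) -> Forall (fun t => a <= t <= b) (t1 :: ts) ->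
  exists t2, t1 <= t2 <= b /\ poly_len g (t1 :: ts) <= F t2 - F t1.
Proof.
  intros HF. induction ts as [|s ts IH]; intros t1 Hsort Hall;
    apply Forall_inv in Hall as Ht1.
  - exists t1. simpl. lra.
  - apply Sorted_inv in Hsort as [Hsort Hhd]. apply HdRel_inv in Hhd.
    apply Forall_inv_tail in Hall. apply Forall_inv in Hall as Hs.
    destruct (IH s Hsort Hall) as [t2 [Ht2 Hlen]].
    exists t2. split; [lra|].
    change (vnorm (vsub (g t1) (g s)) + poly_len g (s :: ts) <= F t2 - F t1).
    rewrite vnorm_sub_comm. specialize (HF t1 s ltac:(lra) ltac:(lra)). lra.
Qed.

(** * Reduction of eels to arcs *)

(** Composing with this retraction onto [[a, b]] extends the restricted curve continuously to the
    whole line. *)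
Definition clamp (a b t : R) : R := Rmax a (Rmin b t).

Lemma clamp_in (a b t : R) : a <= b -> a <= clamp a b t <= b.
Proof.
  intros Hab. split; [apply Rmax_l|]. apply Rmax_lub; [easy|apply Rmin_l].
Qed.

Lemma clamp_id (a b t : R) : a <= t <= b -> clamp a b t = t.
Proof. intros Ht. unfold clamp. rewrite Rmin_right, Rmax_right; lra. Qed.

Lemma clamp_close (a b s t : R) : Rabs (clamp a b s - clamp a b t) <= Rabs (s - t).
Proof.
  unfold clamp. apply Rle_trans with (Rabs (Rmin b s - Rmin b t)).
  - generalize (Rmin b s) (Rmin b t). intros x y. unfold Rmax.
    destruct (Rle_dec a x), (Rle_dec a y); unfold Rabs;
      repeat destruct (Rcase_abs _); lra.
  - unfold Rmin. destruct (Rle_dec b s), (Rle_dec b t); unfold Rabs;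
      repeat destruct (Rcase_abs _); lra.
Qed.

Lemma fst_le_vnorm (p : vec) : Rabs (fst p) <= vnorm p.
Proof.
  apply sqr_le_le; [apply vnorm_ge0|]. rewrite vnorm_sqr, <- Rabs_mult.
  unfold inner. rewrite Rabs_pos_eq; nra.
Qed.

Lemma snd_le_vnorm (p : vec) : Rabs (snd p) <= vnorm p.
Proof.
  apply sqr_le_le; [apply vnorm_ge0|]. rewrite vnorm_sqr, <- Rabs_mult.
  unfold inner. rewrite Rabs_pos_eq; nra.
Qed.

Lemma continuous_on_clamp (I : R -> Prop) (g : R -> vec) (a b : R) :
  continuous_on I g -> a <= b -> (forall t, a <= t <= b -> I t) ->
  vcontinuity (fun t => g (clamp a b t)).
Proof.
  intros Cg Hab HI.
  assert (H : forall t eps, 0 < eps -> exists d, 0 < d /\ forall s, Rabs (s - t) < d ->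
    vnorm (vsub (g (clamp a b s)) (g (clamp a b t))) < eps).
  { intros t eps Heps.
    destruct (Cg (clamp a b t) (HI _ (clamp_in a b t Hab)) eps Heps) as [d [Hd H]].
    exists d. split; [easy|]. intros s Hs. apply H.
    - apply HI, clamp_in, Hab.
    - eapply Rle_lt_trans; [apply clamp_close|easy]. }
  split; intros t eps Heps; destruct (H t eps Heps) as [d [Hd Hs]];
    exists d; (split; [easy|]); intros s [_ Hst];
    (eapply Rle_lt_trans; [|apply (Hs s), Hst]).
  - exact (fst_le_vnorm (vsub (g (clamp a b s)) (g (clamp a b t)))).
  - exact (snd_le_vnorm (vsub (g (clamp a b s)) (g (clamp a b t)))).
Qed.

Lemma eel_restricts_to_arc (lam a b : R) (I : R -> Prop) (g : R -> vec) :
  lam < 1 -> a < b -> (forall t, a <= t <= b -> I t) -> is_eel lam I g ->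
  exists v, eel_arc (Rmax lam 0) a b (fun t => g (clamp a b t)) v.
Proof.
  intros Hlam Hab HI [Cg Hd].
  assert (Hex : forall t, exists d, a <= t < b -> is_right_deriv I g t d /\ d <> (0, 0) /\
    forall u, I u -> u < t ->
      inner d (vsub (g u) (g t)) <= lam * vnorm d * vnorm (vsub (g u) (g t))).
  { intros t. destruct (classic (a <= t < b)) as [Ht|Ht]; [|now exists (0, 0)].
    destruct (Hd t) as [d H]; [apply HI; lra| |now exists d].
    (* [b] lies in [I], so no [t < b] is its maximum and a right derivative exists. *)
    intros [_ Hmax]. assert (Hb : I b) by (apply HI; lra). specialize (Hmax b Hb). lra. }
  apply functional_choice in Hex. destruct Hex as [v Hv].
  assert (Hm1 := Rmax_l lam 0). assert (Hm2 := Rmax_r lam 0).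
  exists v. constructor.
  - split; [easy|]. apply Rmax_lub_lt; lra.
  - apply (continuous_on_clamp I); try easy; lra.
  - intros t Ht. apply vnorm_gt0. now apply Hv.
  - intros t Ht eps Heps. destruct (Hv t Ht) as [Hr _].
    destruct (Hr eps Heps) as [d [Hd0 H]]. exists d. split; [easy|].
    intros t' Ht' Hb. rewrite !clamp_id by lra.
    specialize (H (t' - t) ltac:(lra) ltac:(lra)).
    replace (t + (t' - t)) with t' in H by ring. specialize (H (HI t' ltac:(lra))).
    set (z := vsub (g t') (g t)) in *.
    replace (vsub z (vscale (t' - t) (v t)))
      with (vscale (t' - t) (vsub (vscale (/ (t' - t)) z) (v t))).
    + rewrite vnorm_scale, Rmult_comm by lra. apply Rmult_le_compat_r; lra.
    + clearbody z. destruct z, (v t); unfold vsub, vscale; simpl.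
      apply f_equal2; field; lra.
  - intros u t Hu Ht. rewrite !clamp_id by lra.
    destruct (Hv t ltac:(lra)) as [_ [_ H]].
    assert (Hn : 0 <= vnorm (v t) * vnorm (vsub (g t) (g u)))
      by (apply Rmult_le_pos; apply vnorm_ge0).
    destruct (Rle_lt_or_eq_dec u t) as [Hlt | ->]; [easy| |].
    + specialize (H u (HI u ltac:(lra)) Hlt). rewrite vnorm_sub_comm in H.
      assert (E : inner (v t) (vsub (g u) (g t)) = - inner (v t) (vsub (g t) (g u)))
        by (unfold inner, vsub; simpl; ring).
      rewrite E in H. nra.
    + replace (vsub (g t) (g t)) with (vscale 0 (g t))
        by (destruct (g t); unfold vsub, vscale; simpl; apply f_equal2; ring).
      rewrite vnorm_scale, inner_scaler by lra. lra.
Qed.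

Lemma poly_len_clamp (g : R -> vec) (a b : R) (ts : list R) :
  Forall (fun t => a <= t <= b) ts ->
  poly_len (fun t => g (clamp a b t)) ts = poly_len g ts.
Proof.
  induction 1 as [|t ts Ht Hts IH]; [easy|]. simpl. destruct ts as [|s ts]; [easy|].
  apply Forall_inv in Hts. now rewrite IH, !clamp_id.
Qed.

Lemma sorted_in_range (ts : list R) : forall t1, Sorted Rlt (t1 :: ts) ->
  exists b, In b (t1 :: ts) /\ Forall (fun t => t1 <= t <= b) (t1 :: ts).
Proof.
  induction ts as [|s ts IH]; intros t1 Hsort.
  - exists t1. split; [now left|]. repeat constructor; lra.
  - apply Sorted_inv in Hsort as [Hsort Hhd]. apply HdRel_inv in Hhd.
    destruct (IH s Hsort) as [b [Hb Hall]]. exists b. split; [now right|].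
    apply Forall_inv in Hall as Hs. constructor; [lra|].
    eapply Forall_impl; [|exact Hall]. simpl. intros t Ht. lra.
Qed.

Theorem theorem5p3 (lam : R) (I : R -> Prop) (g : R -> vec) :
  -1 <= lam -> lam < 1 ->
  is_interval I ->
  is_eel lam I g ->
  bounded_image I g ->
  rectifiable I g /\ finite_length I g.
Proof.
  intros _ Hlam HI Heel [M HM].
  enough (HL : finite_length I g).
  { split; [|easy]. destruct HL as [L HL]. intros a b _ _. exists L. intros ts Hs Hts.
    apply HL; [easy|]. eapply Forall_impl; [|exact Hts]. now intros t [Ht _]. }
  (* [K] is fixed before [a] and [b], so it serves every list of times. [M] may be negative when [I]
     is empty. *)
  destruct (arc_dominated (Rmax lam 0) (Rmax M 0)) as [K [HK Hdom]].
  { split; [apply Rmax_r|]. apply Rmax_lub_lt; lra. }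
  { apply Rmax_r. }
  exists K. intros [|a ts] Hsort Hts; [easy|].
  destruct (sorted_in_range ts a Hsort) as [b [Hb Hall]].
  apply (proj1 (Forall_forall I _) Hts) in Hb as HIb.
  apply Forall_inv in Hts as HIa. apply Forall_inv in Hall as Hab.
  assert (HIab : forall t, a <= t <= b -> I t) by (intros t Ht; now apply (HI a t b)).
  destruct (Rle_lt_or_eq_dec a b) as [Hlt | <-]; [easy| |].
  - destruct (eel_restricts_to_arc lam a b I g Hlam Hlt HIab Heel) as [v HA].
    destruct (Hdom a b _ v HA) as [F [HF HFK]].
    { intros t _. eapply Rle_trans; [apply HM, HIab, clamp_in; lra|apply Rmax_l]. }
    destruct (poly_len_dominated _ F a b ts HF a Hsort Hall) as [t2 [Ht2 Hlen]].
    rewrite poly_len_clamp in Hlen by easy.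
    specialize (HFK a t2 ltac:(lra) ltac:(lra)). lra.
  (* If the extreme times coincide, a strictly increasing list has only one point. *)
  - destruct ts as [|s ts]; [easy|exfalso].
    apply Sorted_inv in Hsort as [_ Hhd]. apply HdRel_inv in Hhd.
    apply Forall_inv_tail, Forall_inv in Hall. lra.
Qed.
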